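(* Let $R$ be a ring. Consider the following statements. (1) Every finitely generated $R$-module is a cl.Hilbert module. (2) For each minimal prime ideal $\mathcal{P}$ of $R$, every finitely generated $R/\mathcal{P}$-module is a cl.Hilbert module. (3) The free $R$-module $R\oplus R$ is a cl.Hilbert module. (4) For each minimal prime ideal $\mathcal{P}$ of $R$, the free $R/\mathcal{P}$-module $R/\mathcal{P}\oplus R/\mathcal{P}$ is a cl.Hilbert module. (5) $R$ is a Hilbert ring and for each minimal prime ideal $\mathcal{P}$ of $R$, the ring $R/\mathcal{P}$ is a Dedekind domain. Then $(1)\Leftrightarrow(2)\Rightarrow(3)\Leftrightarrow(4)$ and $(5)\Rightarrow(1)$. When $R$ is a Noetherian ring, all five statements are equivalent.
   Context: All rings are commutative with identity $1\neq 0$ and all modules are unital. A proper submodule $P$ of an $R$-module $M$ is classical prime if for all $a,b\in R$ and $m\in M$, $abm\in P$ implies $am\in P$ or $bm\in P$. An $R$-module $M$ is a cl.Hilbert module (classical Hilbert module) if every classical prime submodule of $M$ is an intersection of maximal submodules of $M$. A ring $R$ is a Hilbert ring if every prime ideal of $R$ is an intersection of maximal ideals. A Dedekind domain is an integral domain in which every proper ideal is a product of a finite number of prime ideals (so fields are Dedekind domains). *)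

(* Defs.v *)
From HB Require Import structures.
From mathcomp Require Import all_boot all_order all_algebra.
From mathcomp Require Import ring_quotient boolp.

Set Implicit Arguments.
Unset Strict Implicit.
Unset Printing Implicit Defensive.

Import GRing.Theory.
Local Open Scope ring_scope.

(* Submodules and ideals are boolean predicates, as in ssralg and
   ring_quotient. In the classical setting of boolp this is no restriction:
   any P : T -> Prop gives the boolean predicate [pred x | `[< P x >]]. *)

Section Modules.
Variables (R : comNzRingType) (M : lmodType R).
Implicit Types (N P : {pred M}).

Definition proper_submodule N : Prop :=
  submod_closed N /\ exists m : M, m \notin N.

Definition maximal_submodule N : Prop :=
  proper_submodule N /\
  forall N' : {pred M}, proper_submodule N' ->
    {subset N <= N'} -> {subset N' <= N}.

Definition classical_prime P : Prop :=
  proper_submodule P /\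
  forall (a b : R) (m : M),
    (a * b) *: m \in P -> (a *: m \in P) \/ (b *: m \in P).

Definition cl_Hilbert : Prop :=
  forall P : {pred M}, classical_prime P ->
    exists F : {pred M} -> Prop,
      (forall N, F N -> maximal_submodule N) /\
      (forall m : M, m \in P <-> (forall N, F N -> m \in N)).

Definition fg_submodule N : Prop :=
  exists (n : nat) (e : 'I_n -> M),
    forall m : M, m \in N <-> exists c : 'I_n -> R, m = \sum_i c i *: e i.

Definition finitely_generated : Prop := fg_submodule predT.

End Modules.

Section Rings.
Variable R : comNzRingType.

(* Ideals are the submodules of the regular module R^o. *)
Definition noetherian : Prop :=
  forall I : {pred R^o}, submod_closed I -> fg_submodule I.

(* Elements of idealr R are proper ideals, elements of prime_idealr R are
   (proper) prime ideals. *)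
Definition maximal_ideal (I : idealr R) : Prop :=
  forall J : idealr R, {subset I <= J} -> {subset J <= I}.

Definition Hilbert_ring : Prop :=
  forall P : prime_idealr R,
    exists F : idealr R -> Prop,
      (forall I, F I -> maximal_ideal I) /\
      (forall x : R, x \in P <-> (forall I, F I -> x \in I)).

Definition minimal_prime (P : prime_idealr R) : Prop :=
  forall Q : prime_idealr R, {subset Q <= P} -> {subset P <= Q}.

Definition ideal_mul (I J : {pred R}) : {pred R} :=
  [pred x | `[< exists (n : nat) (a b : 'I_n -> R),
     [/\ forall i, a i \in I, forall i, b i \in J
       & x = \sum_i a i * b i] >]].

Definition Dedekind_domain : Prop :=
  GRing.integral_domain_axiom R /\
  forall I : idealr R, exists s : seq (prime_idealr R),
    I =i foldr (fun (Q : prime_idealr R) J => ideal_mul Q J) predT s.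

Definition fg_modules_cl_Hilbert : Prop :=
  forall M : lmodType R, finitely_generated M -> cl_Hilbert M.

Definition free2_cl_Hilbert : Prop := cl_Hilbert (R^o * R^o)%type.

End Rings.

(* Main.v *)
Require Import Defs.
From HB Require Import structures.
From mathcomp Require Import all_boot all_order all_algebra.
From mathcomp Require Import ring_quotient generic_quotient boolp classical_sets.
From mathcomp Require Import ring.

Set Implicit Arguments.
Unset Strict Implicit.
Unset Printing Implicit Defensive.

Import GRing.Theory.
Local Open Scope classical_set_scope.
Local Open Scope ring_scope.

(** The annihilators of the elements of M / N, for N classical prime, form a
    chain of primes, so (N : M) is prime and contains a minimal prime P of R;
    hence everything can be tested over the domains D = R / P.

    Let D be Dedekind with zero Jacobson radical, m outside N and
    q = (N : m).  If q = 0, a linear functional on M / N that does not vanish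
    at m and a maximal ideal avoiding its value give a maximal submodule
    avoiding m.  Otherwise q is maximal and locally generated by some p, and
    classical primeness shows that m is not in N + q M, so a hyperplane of
    M / (N + q M) avoids m.

    Conversely let D be a Noetherian domain with D + D cl.Hilbert, q a prime
    and a, b in D with a <> 0.  Let L be the module of the pairs (x, y)
    proportional to (a, b).  The intersection of L with q L_q is a classical
    prime submodule, and by Nakayama it misses some (x, y) in L.  A maximal
    submodule avoiding (x, y) shows that x and y are not both in q, that is, a
    divides b or b divides a locally at q.  So the localizations are valuation
    rings, and Noetherian induction on I = m (I : m) factors every ideal. *)

(** * Submodules, classical primes and semilinear surjections *)

Definition setpred (T : Type) (A : set T) : {pred T} := fun x => `[< A x >].

Lemma in_setpred (T : Type) (A : set T) x :
  (x \in setpred A) = A x :> Prop.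
Proof. exact: asboolE. Qed.

(** Zorn's lemma is applied to the sets whose union with [A0] satisfies [C]: the empty chain is then
    settled by [C A0], and only nonempty chains need a hypothesis. *)
Lemma Zorn_above (T : Type) (C : set (set T)) (A0 : set T) :
  C A0 ->
  (forall F : set (set T), F `<=` C -> F !=set0 -> total_on F subset ->
     C (\bigcup_(X in F) X)) ->
  exists A, [/\ C A, A0 `<=` A & forall B, C B -> A `<=` B -> B `<=` A].
Proof.
move=> CA0 chain.
have [|A [PA Amax]] := @Zorn_bigcup T [set A | C (A `|` A0)].
  move=> F FC Ftot /=; have [->|/set0P[X0 FX0]] := eqVneq F set0.
    by rewrite bigcup_set0 set0U.
  set U := \bigcup_(X in F) X.
  have -> : U `|` A0 = \bigcup_(X in [set X `|` A0 | X in F]) X.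
    apply/seteqP; split=> [x [[X FX Xx]|A0x]|x [_ [X FX <-]] [Xx|A0x]].
    - by exists (X `|` A0); [exists X | left].
    - by exists (X0 `|` A0); [exists X0 | right].
    - by left; exists X.
    - by right.
  apply: chain => [_ [X FX <-]||_ _ [X FX <-] [Y FY <-]].
  - exact: FC.
  - by exists (X0 `|` A0); exists X0.
  - by have [XY|YX] := Ftot _ _ FX FY; [left|right]; apply: setSU.
exists (A `|` A0); split=> // B CB AB x Bx; apply: contrapT => nAx.
apply: (Amax B); last by rewrite /= setUidl // => y A0y; apply: AB; right.
split=> [y Ay|BA]; first by apply: AB; left.
by apply: nAx; left; apply: BA.
Qed.

Section Submodules.
Variables (R : comNzRingType) (M : lmodType R).
Implicit Types (N X : set M).

Definition submod N : Prop :=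
  [/\ N 0, forall u v, N u -> N v -> N (u + v) & forall a u, N u -> N (a *: u)].

Definition cl_prime N : Prop :=
  [/\ submod N, exists m, ~ N m
    & forall (a b : R) m, N ((a * b) *: m) -> N (a *: m) \/ N (b *: m)].

(* A proper submodule X is maximal iff X + R x = M for every x outside X. *)
Definition max_submod X : Prop :=
  [/\ submod X, exists m, ~ X m
    & forall x, ~ X x -> forall y, exists a : R, X (y - a *: x)].

Lemma submodN N u : submod N -> N u -> N (- u).
Proof. by case=> _ _ NZ Nu; rewrite -scaleN1r; apply: NZ. Qed.

Lemma submodB N u v : submod N -> N u -> N v -> N (u - v).
Proof. by move=> sN Nu Nv; case: (sN) => _ ND _; apply: ND => //; apply: submodN. Qed.

Lemma submodDl N u v : submod N -> N u -> N (u + v) -> N v.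
Proof. by move=> sN Nu Nuv; rewrite -(addKr u v) addrC; apply: submodB. Qed.

Lemma submod_sum N (n : nat) (F : 'I_n -> M) :
  submod N -> (forall i, N (F i)) -> N (\sum_i F i).
Proof. by case=> N0 ND _ NF; apply: big_ind. Qed.

Lemma submod_closedP (P : {pred M}) : submod_closed P <-> submod [set x | x \in P].
Proof.
split=> [[P0 PZ]|[P0 PD PZ]]; last first.
  by split=> // a u v Pu Pv; apply: PD => //; apply: PZ.
split=> //= [u v Pu Pv|a u Pu]; first by rewrite -[u]scale1r; apply: PZ.
by rewrite -[_ *: _]addr0; apply: PZ.
Qed.

Lemma setpredK N : [set x | x \in setpred N] = N.
Proof. by apply/seteqP; split=> x /=; rewrite in_setpred. Qed.

Lemma submod_bigcup (F : set (set M)) :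
  F !=set0 -> total_on F subset -> (forall X, F X -> submod X) ->
  submod (\bigcup_(X in F) X).
Proof.
move=> [X0 FX0] Ftot sF; split=> [|u v [X FX Xu] [Y FY Yv]|a u [X FX Xu]].
- by exists X0 => //; have [] := sF _ FX0.
- have [XY|YX] := Ftot _ _ FX FY.
    by exists Y => //; have [_ D _] := sF _ FY; apply: D => //; apply: XY.
  by exists X => //; have [_ D _] := sF _ FX; apply: D => //; apply: YX.
- by exists X => //; have [_ _ Z] := sF _ FX; apply: Z.
Qed.

Lemma submod_adjoin N x : submod N -> submod [set y | exists a : R, N (y - a *: x)].
Proof.
case=> N0 ND NZ; split=> [|u v [a Na] [b Nb]|a u [b Nb]].
- by exists 0; rewrite scale0r subr0.
- by exists (a + b); rewrite scalerDl opprD addrACA; apply: ND.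
- by exists (a * b); rewrite -scalerA -scalerBr; apply: NZ.
Qed.

Lemma maximal_submoduleP (P : {pred M}) :
  maximal_submodule P <-> max_submod [set x | x \in P].
Proof.
split=> [[[/submod_closedP sP [m0 Pm0]] Pmax]|[/submod_closedP sP [m0 Pm0] Pmax]].
  split=> //= [|x nPx y]; first by exists m0; apply/negP.
  apply: contrapT => nPy.
  pose Q := setpred [set y | exists a : R, y - a *: x \in P].
  have Qx : x \in Q.
    by rewrite in_setpred; exists 1; rewrite scale1r subrr; case: sP.
  apply/nPx/(Pmax Q) => //.
    split; last by exists y; apply/negP; rewrite in_setpred.
    by apply/submod_closedP; rewrite setpredK; exact: (submod_adjoin x sP).
  by move=> z Pz; rewrite in_setpred; exists 0; rewrite scale0r subr0.
split; first by split=> //; exists m0; apply/negP.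
move=> Q [/submod_closedP [Q0 QD QZ] [m Qm]] PQ x Qx; apply: contrapT => nPx.
have [a /= /PQ Qma] := Pmax x nPx m.
by move/negP: Qm; apply; rewrite -(subrK (a *: x) m); apply: QD => //; apply: QZ.
Qed.

Lemma classical_primeP (P : {pred M}) :
  classical_prime P <-> cl_prime [set x | x \in P].
Proof.
split=> [[[/submod_closedP sP [m0 Pm0]] Pmax]|[/submod_closedP sP [m0 Pm0] Pmax]].
  by split=> //; exists m0; apply/negP.
by split=> //; split=> //; exists m0; apply/negP.
Qed.

(** An intersection of maximal submodules is also the intersection of all maximal submodules above
    it, so the property amounts to separating points from classical primes. *)
Lemma cl_HilbertP : cl_Hilbert M <->
  forall N m, cl_prime N -> ~ N m ->
    exists X, [/\ max_submod X, N `<=` X & ~ X m].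
Proof.
split=> [H N m Np nNm|H P /classical_primeP Pp].
  have [|F [Fmax FN]] := H (setpred N).
    by apply/classical_primeP; rewrite setpredK.
  apply: contrapT => nX; apply: nNm; rewrite -in_setpred; apply/FN => X FX.
  apply/negPn/negP => nXm; apply: nX; exists [set x | x \in X]; split.
  - exact/maximal_submoduleP/Fmax.
  - by move=> x; rewrite -in_setpred => /FN; apply.
  - exact/negP.
exists (fun X : {pred M} => maximal_submodule X /\ {subset P <= X}); split=> [X []//|m].
split=> [Pm X [_]|Xm]; first exact.
apply: contrapT => nPm; have [X [Xmax PX nXm]] := H _ m Pp nPm.
apply: nXm; rewrite -in_setpred; apply: Xm; split.
  by apply/maximal_submoduleP; rewrite setpredK.
by move=> x Px; rewrite in_setpred; apply: PX.
Qed.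

End Submodules.

(** * Transfer along a surjection that is semilinear over a ring surjection *)

Section Transfer.
Variables (R S : comNzRingType) (f : {rmorphism R -> S}).
Variables (M : lmodType R) (M' : lmodType S) (g : {additive M -> M'}).
Hypothesis f_surj : forall s, exists a, f a = s.
Hypothesis g_surj : forall y, exists x, g x = y.
Hypothesis gZ : forall a x, g (a *: x) = f a *: g x.

Lemma submod_preim N : submod N -> submod (g @^-1` N).
Proof.
case=> N0 ND NZ; split=> /= [|u v Nu Nv|a u Nu]; first by rewrite raddf0.
  by rewrite raddfD; apply: ND.
by rewrite gZ; apply: NZ.
Qed.

Lemma submod_im N : submod N -> submod (g @` N).
Proof.
case=> N0 ND NZ; split=> [|_ _ [u Nu <-] [v Nv <-]|s _ [u Nu <-]].
- by exists 0; rewrite ?raddf0.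
- by exists (u + v); [apply: ND|rewrite raddfD].
- by have [a <-] := f_surj s; exists (a *: u); [apply: NZ|rewrite gZ].
Qed.

(** Correspondence theorem: a submodule containing the kernel is recovered from its image. *)
Lemma submod_im_mem N x :
  submod N -> (forall x, g x = 0 -> N x) -> (g @` N) (g x) -> N x.
Proof.
move=> sN kerN [u Nu gux]; apply: (@submodDl _ _ N (- u)) => //.
  exact: submodN.
by apply: kerN; rewrite raddfD raddfN gux addNr.
Qed.

Lemma cl_prime_preim N : cl_prime N -> cl_prime (g @^-1` N).
Proof.
case=> sN [y nNy] Np; split; first exact: submod_preim.
  by have [x gx] := g_surj y; exists x => /=; rewrite gx.
by move=> a b m /=; rewrite !gZ rmorphM; apply: Np.
Qed.

Lemma cl_prime_im N :
  (forall x, g x = 0 -> N x) -> cl_prime N -> cl_prime (g @` N).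
Proof.
move=> kerN [sN [m nNm] Np]; split; first exact: submod_im.
  by exists (g m) => /(submod_im_mem sN kerN).
move=> a b y; have [[a' <-] [b' <-]] := (f_surj a, f_surj b).
have [x <-] := g_surj y; rewrite -rmorphM -!gZ.
by move=> /(submod_im_mem sN kerN)/Np[Nx|Nx]; [left; exists (a' *: x)|right; exists (b' *: x)].
Qed.

Lemma max_submod_preim X : max_submod X -> max_submod (g @^-1` X).
Proof.
case=> sX [y nXy] Xmax; split; first exact: submod_preim.
  by have [x gx] := g_surj y; exists x => /=; rewrite gx.
move=> x /Xmax H z; have [s] := H (g z); have [a <-] := f_surj s => Xs.
by exists a; rewrite /= raddfB gZ.
Qed.

Lemma max_submod_im X :
  (forall x, g x = 0 -> X x) -> max_submod X -> max_submod (g @` X).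
Proof.
move=> kerX [sX [m nXm] Xmax]; split; first exact: submod_im.
  by exists (g m) => /(submod_im_mem sX kerX).
move=> x nXx y; have [[x' gx] [y' gy]] := (g_surj x, g_surj y).
have nXx' : ~ X x' by apply: contra_not nXx => Xx'; exists x'.
have [a Xa] := Xmax x' nXx' y'; exists (f a); exists (y' - a *: x') => //.
by rewrite raddfB gZ gx gy.
Qed.

Lemma cl_Hilbert_im : cl_Hilbert M -> cl_Hilbert M'.
Proof.
move=> /cl_HilbertP H; apply/cl_HilbertP => N m Np nNm.
have [x gx] := g_surj m; case: (Np) => -[N0 _ _] _ _.
have [||X [Xmax NX nXx]] := H (g @^-1` N) x; first exact: cl_prime_preim.
  by rewrite /= gx.
have kerX y : g y = 0 -> X y by move=> gy; apply: NX; rewrite /= gy.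
exists (g @` X); split; first exact: max_submod_im.
  by move=> y Ny; have [z gz] := g_surj y; exists z => //; apply: NX; rewrite /= gz.
by case: Xmax => sX _ _; rewrite -gx => /(submod_im_mem sX kerX).
Qed.

(** Only [M'] is known to be cl.Hilbert, so this concerns a single [N] above the kernel: its image
    is classical prime, and the maximal submodule found in [M'] is pulled back. *)
Lemma cl_Hilbert_preim N m :
  cl_Hilbert M' -> cl_prime N -> (forall x, g x = 0 -> N x) -> ~ N m ->
  exists X, [/\ max_submod X, N `<=` X & ~ X m].
Proof.
move=> /cl_HilbertP H Np kerN nNm; have sN : submod N by case: Np.
have [||X [Xmax NX nXm]] := H (g @` N) (g m); first exact: cl_prime_im.
  by move=> /(submod_im_mem sN kerN).
exists (g @^-1` X); split=> //; first exact: max_submod_preim.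
by move=> x Nx; apply: NX; exists x.
Qed.

Lemma finitely_generated_im : finitely_generated M -> finitely_generated M'.
Proof.
move=> [n [e gen]]; exists n, (g \o e) => y; split=> // _.
have [x <-] := g_surj y; have /gen[c ->] : x \in predT by [].
by exists (f \o c); rewrite raddf_sum; apply: eq_bigr => i _; rewrite gZ.
Qed.

End Transfer.

(** * Restriction of scalars and quotient modules *)

Definition restr (R S : comNzRingType) (f : {rmorphism R -> S}) (M : lmodType S) : Type := M.

Section Restriction.
Variables (R S : comNzRingType) (f : {rmorphism R -> S}) (M : lmodType S).
HB.instance Definition _ := GRing.Zmodule.copy (restr f M) M.

Definition restr_scale (a : R) (x : restr f M) : restr f M := f a *: (x : M).

Fact restr_scaleA a b x : restr_scale a (restr_scale b x) = restr_scale (a * b) x.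
Proof. by rewrite /restr_scale scalerA rmorphM. Qed.
Fact restr_scale1 : left_id 1 restr_scale.
Proof. by move=> x; rewrite /restr_scale rmorph1 scale1r. Qed.
Fact restr_scaleDr : right_distributive restr_scale +%R.
Proof. by move=> a x y; rewrite /restr_scale scalerDr. Qed.
Fact restr_scaleDl x : {morph restr_scale^~ x : a b / a + b}.
Proof. by move=> a b; rewrite /restr_scale rmorphD scalerDl. Qed.

HB.instance Definition _ := GRing.Zmodule_isLmodule.Build R (restr f M)
  restr_scaleA restr_scale1 restr_scaleDr restr_scaleDl.
End Restriction.

Lemma finitely_generated_restr (R S : comNzRingType) (f : {rmorphism R -> S})
    (M : lmodType S) : (forall s, exists a, f a = s) ->
  finitely_generated M -> finitely_generated (restr f M).
Proof.
move=> f_surj [n [e gen]]; exists n, e => y; split=> // _.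
have /gen[c ->] : (y : M) \in predT by [].
have [h fh] := boolp.choice f_surj.
exists (h \o c); apply: eq_bigr => i _ /=.
by rewrite -[RHS]/(f (h (c i)) *: (e i : M)) fh.
Qed.

(** [M / N] becomes an [S]-module because the kernel of [f] annihilates it. *)
Lemma quotient_module (R S : comNzRingType) (f : {rmorphism R -> S})
    (M : lmodType R) (N : set M) :
  (forall s, exists a, f a = s) -> submod N ->
  (forall a x, f a = 0 -> N (a *: x)) ->
  exists (Q : lmodType S) (g : {additive M -> Q}),
    [/\ forall y, exists x, g x = y, forall a x, g (a *: x) = f a *: g x
      & forall x, g x = 0 <-> N x].
Proof.
move=> f_surj sN kerN; case: (sN) => N0 ND NZ.
have closedN : zmod_closed (setpred N).
  split=> [|x y]; first by rewrite in_setpred.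
  by rewrite !in_setpred; apply: submodB.
pose K : zmodClosed M := HB.pack (setpred N) (GRing.isZmodClosed.Build M _ closedN).
pose q : {additive M -> (Quotient.quot K)} := \pi_(Quotient.quot K)%qT.
have eq_q x y : q x = q y <-> N (x - y).
  by rewrite -[N _](in_setpred N) (Quotient.idealrBE K); split=> /eqP.
have [h fh] := boolp.choice f_surj.
(* Scalars act through chosen lifts and representatives; [scE] shows that neither choice matters,
   and the module axioms follow from it. *)
pose sc (s : S) (x : (Quotient.quot K)) : (Quotient.quot K) := q (h s *: repr x).
have qK x : q (repr x) = x by rewrite /q /= reprK.
have scE a x : sc (f a) (q x) = q (a *: x).
  apply/eq_q; have /eq_q/(NZ (h (f a))) := qK (q x).
  have := kerN (h (f a) - a) x; rewrite rmorphB fh subrr scalerBl scalerBr.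
  by move=> /(_ erefl) N1 N2; have := ND _ _ N1 N2; rewrite addrC addrA subrK.
have scA s t x : sc s (sc t x) = sc (s * t) x.
  have [[a <-] [b <-]] := (f_surj s, f_surj t); rewrite -[x]qK.
  by rewrite !scE -rmorphM scE scalerA.
have sc1 : left_id 1 sc by move=> x; rewrite -[x]qK -(rmorph1 f) scE scale1r.
have scDr : right_distributive sc +%R.
  move=> s x y; have [a <-] := f_surj s; rewrite -[x]qK -[y]qK.
  by rewrite -raddfD !scE scalerDr raddfD.
have scDl x : {morph sc^~ x : s t / s + t}.
  move=> s t; have [[a <-] [b <-]] := (f_surj s, f_surj t); rewrite -[x]qK.
  by rewrite -rmorphD !scE scalerDl raddfD.
pose Q : lmodType S := HB.pack (Quotient.quot K)
  (GRing.Zmodule_isLmodule.Build S (Quotient.quot K) scA sc1 scDr scDl).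
exists Q, q; split=> [y|a x|x]; first by exists (repr y); apply: qK.
  by rewrite -scE.
by rewrite -(raddf0 q) eq_q subr0.
Qed.

(** * Ideals as sets, and minimal primes *)

Section Ideals.
Variable R : comNzRingType.
Implicit Types I J : set R.

Definition ideal I : Prop :=
  [/\ I 0, forall u v, I u -> I v -> I (u + v) & forall a u, I u -> I (a * u)].

Definition prime_ideal I : Prop :=
  [/\ ideal I, ~ I 1 & forall a b, I (a * b) -> I a \/ I b].

(** The last clause says that [R / I] is a field: each [x] outside [I] is invertible modulo [I]. *)
Definition max_ideal I : Prop :=
  [/\ ideal I, ~ I 1 & forall x, ~ I x -> exists a, I (1 - a * x)].

Lemma idealr_ideal (I : idealr R) : ideal [set x | x \in I].
Proof.
by split=> [|u v|a u] /=; [exact: rpred0 | exact: rpredD | exact: idealMr].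
Qed.

Lemma prime_idealr_prime_ideal (P : prime_idealr R) : prime_ideal [set x | x \in P].
Proof.
split; [exact: idealr_ideal | by rewrite /= idealr1|].
by move=> a b /=; rewrite prime_idealrM => /orP.
Qed.

Lemma ideal_idealr I : ideal I -> ~ I 1 -> exists J : idealr R, [set x | x \in J] = I.
Proof.
case=> I0 ID IM nI1.
have idI : idealr_closed (setpred I).
  split=> [||a u v]; first by rewrite in_setpred.
    by apply/negP; rewrite in_setpred.
  by rewrite !in_setpred => Iu Iv; apply: ID => //; apply: IM.
pose J : idealr R := HB.pack (setpred I) (isIdealr.Build R _ idI).
by exists J; apply/seteqP; split=> x /=; rewrite in_setpred.
Qed.

Lemma prime_ideal_prime_idealr I :
  prime_ideal I -> exists J : prime_idealr R, [set x | x \in J] = I.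
Proof.
case=> -[I0 ID IM] nI1 Ip.
have idI : idealr_closed (setpred I).
  split=> [||a u v]; first by rewrite in_setpred.
    by apply/negP; rewrite in_setpred.
  by rewrite !in_setpred => Iu Iv; apply: ID => //; apply: IM.
have pI : prime_idealr_closed (setpred I).
  move=> u v; rewrite in_setpred => /Ip[Iu|Iv]; apply/orP.
    by left; rewrite in_setpred.
  by right; rewrite in_setpred.
pose J : prime_idealr R := HB.pack (setpred I) (isIdealr.Build R _ idI)
  (isPrimeIdealrClosed.Build R _ pI).
by exists J; apply/seteqP; split=> x /=; rewrite in_setpred.
Qed.

Lemma ideal_adjoin I x : ideal I -> ideal [set y | exists a, I (y - a * x)].
Proof. exact: (@submod_adjoin _ R^o I x). Qed.

Lemma max_idealP (I : idealr R) : maximal_ideal I -> max_ideal [set x | x \in I].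
Proof.
move=> Imax; split; [exact: idealr_ideal | by rewrite /= idealr1|].
move=> x nIx; apply: contrapT => nI1.
have [J JE] := ideal_idealr (ideal_adjoin x (idealr_ideal I)) nI1.
apply: nIx; apply: (Imax J).
  by move=> y Iy; suff: [set` J] y by []; rewrite JE; exists 0; rewrite mul0r subr0.
suff: [set` J] x by []; rewrite JE; exists 1; rewrite mul1r subrr; exact: rpred0.
Qed.

Lemma max_ideal_maximal I (J : idealr R) :
  max_ideal I -> [set x | x \in J] = I -> maximal_ideal J.
Proof.
move=> Imax JE K JK x Kx; apply: contrapT => nJx.
have [_ _ /(_ x)] := Imax; rewrite -JE => /(_ nJx)[a /= /JK K1].
have := idealr1 K; rewrite -(subrK (a * x) 1) => /negP; apply.
by apply: rpredD => //; apply: idealMr.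
Qed.

Lemma max_ideal_prime I : max_ideal I -> prime_ideal I.
Proof.
case=> -[I0 ID IM] nI1 Imax; split=> // a b Iab.
have [|nIa] := pselect (I a); [by left | right].
have [c Ic] := Imax a nIa; have -> : b = b * (1 - c * a) + c * (a * b) by ring.
by apply: ID; apply: IM.
Qed.

(** Zorn's lemma is used on the removed sets [A]: growing [A] means shrinking primes [I \ A], and
    the intersection of a chain of primes is prime. *)
Lemma minimal_prime_below I : prime_ideal I ->
  exists P : prime_idealr R, minimal_prime P /\ [set x | x \in P] `<=` I.
Proof.
move=> Ip.
have [||A [Ap _ Amax]] := @Zorn_above R [set A | prime_ideal (I `\` A)] set0.
- by rewrite /= setD0.
- move=> F Fp [X0 FX0] Ftot /=; split.
  + split=> [|u v [Iu nFu] [Iv nFv]|a u [Iu nFu]].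
    * split=> [|[X FX X0']]; first by case: Ip => -[].
      by have [[[_ []]]] := Fp X FX.
    * case: Ip => -[_ ID _] _ _; split=> [|[X FX Xuv]]; first exact: ID.
      have [[_ D _] _ _] := Fp X FX; case: (D u v) => // ; split=> // Xx.
        by apply: nFu; exists X.
      by apply: nFv; exists X.
    * case: Ip => -[_ _ IM] _ _; split=> [|[X FX Xuv]]; first exact: IM.
      have [[_ _ Z] _ _] := Fp X FX; case: (Z a u) => // ; split=> // Xx.
      by apply: nFu; exists X.
  + by case: Ip => _ nI1 _ [].
  + move=> a b [Iab nFab]; apply: contrapT => /not_orP[na nb].
    have memF c : ~ (I `\` \bigcup_(X in F) X) c -> ~ I c \/ exists2 X, F X & X c.
      move=> nc; have [Ic|] := pselect (I c); [right|by left].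
      by apply: contrapT => nFc; apply: nc.
    have notF c X : F X -> ~ I c -> ~ (I `\` X) c by move=> _ nIc [].
    have ex2 : exists X, [/\ F X, ~ (I `\` X) a & ~ (I `\` X) b].
      have [nIa|[X FX Xa]] := memF a na; have [nIb|[Y FY Yb]] := memF b nb.
      - by exists X0; split=> // -[].
      - by exists Y; split=> // -[].
      - by exists X; split=> // -[].
      - have [XY|YX] := Ftot X Y FX FY.
          by exists Y; split=> // -[_]; apply=> //; apply: XY.
        by exists X; split=> // -[_]; apply=> //; apply: YX.
    have [X [FX nXa nXb]] := ex2; have [_ _ P] := Fp X FX.
    case: (P a b) => //; split=> // Xab; apply: nFab; by exists X.
have [P PE] := prime_ideal_prime_idealr Ap; exists P; split; last by rewrite PE => x [].
move=> Q QP x Px; apply: contrapT => nQx.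
have QI : [set z | z \in Q] `<=` I.
  by move=> z Qz; have := QP z Qz : [set` P] z; rewrite PE => -[].
have := Px : [set` P] x; rewrite PE => -[Ix nAx].
apply: nAx; apply: (Amax (~` [set z | z \in Q])) => //=.
  by rewrite setDE setCK (setIidr QI); exact: prime_idealr_prime_ideal.
by move=> z Az Qz; have := QP z Qz : [set` P] z; rewrite PE => -[_]; apply.
Qed.

End Ideals.

(** If [a x] and [b y] lay outside [N] while [a b] kills [M / N], classical primeness would put
    [b x] and [a y] in [N], and applying it to [x + y] gives a contradiction. *)
Lemma cl_prime_colon (R : comNzRingType) (M : lmodType R) (N : set M) :
  cl_prime N -> prime_ideal [set a | forall x, N (a *: x)].
Proof.
move=> [sN [m nNm] Np]; case: (sN) => N0 ND NZ; split.
- split=> [x|u v Nu Nv x|a u Nu x]; rewrite ?scale0r ?scalerDl -?scalerA //.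
    exact: ND.
  exact: NZ.
- by move=> /(_ m); rewrite scale1r.
- move=> a b Nab; apply: contrapT => /not_orP[/existsNP[x nNax] /existsNP[y nNby]].
  have Nbx : N (b *: x) by case: (Np a b x (Nab x)).
  have Nay : N (a *: y) by case: (Np a b y (Nab y)).
  case: (Np a b (x + y) (Nab _)); rewrite scalerDr.
    by rewrite addrC => /(submodDl sN Nay).
  by move=> /(submodDl sN Nbx).
Qed.

(** * Finitely generated modules over a domain *)

(** [M / N] is a vector space over the field [R / r]; a submodule above [N] that is maximal among
    those avoiding [m] is a hyperplane. *)
Lemma hyperplane (R : comNzRingType) (M : lmodType R) (N : set M) (r : set R) m :
  submod N -> max_ideal r -> (forall a x, r a -> N (a *: x)) -> ~ N m ->
  exists X, [/\ max_submod X, N `<=` X & ~ X m].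
Proof.
move=> sN [_ _ rmax] rN nNm.
have [||X [[sX nXm] NX Xmax]] := @Zorn_above M [set X | submod X /\ ~ X m] N.
- by [].
- move=> F FC F0 Ftot; split=> [|[X /FC[_ nXm] /nXm]] //.
  by apply: submod_bigcup => // X /FC[].
have [X0 XD XZ] := sX.
have hit x : ~ X x -> exists2 a, ~ r a & X (m - a *: x).
  move=> nXx; have [a Xa] : exists a, X (m - a *: x).
    apply: contrapT => nB; apply: nXx.
    apply: (Xmax [set y | exists a, X (y - a *: x)]).
    - by split=> //; exact: submod_adjoin.
    - by move=> y Xy; exists 0; rewrite scale0r subr0.
    - by exists 1; rewrite scale1r subrr.
  exists a => // ra; apply: nXm; rewrite -(subrK (a *: x) m).
  by apply: XD => //; apply/NX/rN.
exists X; split=> //; split=> //; first by exists m.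
move=> x /hit[a nra Xa] y; have [Xy|/hit[d nrd Xd]] := pselect (X y).
  by exists 0; rewrite scale0r subr0.
(* [e] inverts [d] modulo [r], so modulo [X] one has [y = e d y = e m = e a x]. *)
have [e re] := rmax d nrd; exists (e * a).
have -> : y - (e * a) *: x =
    (1 - e * d) *: y + (e *: (m - a *: x) - e *: (m - d *: y)).
  rewrite scalerBl scale1r !scalerBr !scalerA opprB [e *: m - _]addrC.
  by rewrite [_ + _ + (_ - _)]addrACA subrr addr0 addrACA addNr addr0.
by apply: XD; [apply/NX/rN | apply: submodB => //; apply: XZ].
Qed.

Section DomainModules.
Variables (D : comNzRingType) (domD : forall a b : D, a * b = 0 -> a = 0 \/ b = 0).
Variables (M : lmodType D).

Lemma domain_prod_neq0 (n : nat) (c : 'I_n -> D) :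
  (forall i, c i <> 0) -> \prod_i c i <> 0.
Proof.
move=> c0; apply: (big_ind (fun x => x <> 0)) => [|a b a0 b0 /domD[]|i _] //.
by apply/eqP; exact: oner_neq0.
Qed.

Definition saturated (T : set M) : Prop :=
  forall d x, d <> 0 -> T (d *: x) -> T x.

(* A maximal saturated submodule avoiding m has a quotient of rank one, on
   which c x = l(x) m defines a linear functional with l(m) = c <> 0. *)
Lemma max_submod_saturated (T : set M) m :
  finitely_generated M ->
  (forall c : D, c <> 0 -> exists2 r, max_ideal r & ~ r c) ->
  submod T -> saturated T -> ~ T m ->
  exists X, [/\ max_submod X, T `<=` X & ~ X m].
Proof.
move=> [n [e gen]] jac sT satT nTm.
have [||S [[sS satS nSm] TS Smax]] :=
  @Zorn_above M [set X | [/\ submod X, saturated X & ~ X m]] T.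
- by [].
- move=> F FC F0 Ftot; split=> [|d x d0 [X FX Xdx]|[X /FC[_ _ nXm] /nXm]] //.
    by apply: submod_bigcup => // X /FC[].
  by exists X => //; have [_ satX _] := FC X FX; apply: satX Xdx.
have [S0 SD SZ] := sS.
have rank1 x : exists cd : D * D, cd.1 <> 0 /\ S (cd.1 *: x - cd.2 *: m).
  have [Sx|nSx] := pselect (S x).
    exists (1, 0); split=> /=; first by apply/eqP; exact: oner_neq0.
    by rewrite scale1r scale0r subr0.
  (* The set given to [Smax] is the saturation of [S + D x]; being larger than [S], it must contain
     [m]. *)
  have [[d a] /= [d0 Sda]] : exists da : D * D, da.1 <> 0 /\ S (da.1 *: m - da.2 *: x).
    apply: contrapT => nB; apply: nSx.
    apply: (Smax [set y | exists da : D * D, da.1 <> 0 /\ S (da.1 *: y - da.2 *: x)]).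
    - split=> //.
        split=> [|u v [[d a] /= [d0 Sda]] [[d' a'] /= [d'0 Sda']]|b u [[d a] /= [d0 Sda]]].
        + exists (1, 0) => /=; split; first by apply/eqP; exact: oner_neq0.
          by rewrite scale0r subr0 scaler0.
        + exists (d * d', d' * a + d * a') => /=; split; first by move=> /domD[].
          have -> : (d * d') *: (u + v) - (d' * a + d * a') *: x =
              d' *: (d *: u - a *: x) + d *: (d' *: v - a' *: x).
            rewrite scalerDr scalerDl opprD addrACA !scalerBr !scalerA.
            by rewrite [d' * d]mulrC.
          by apply: SD; apply: SZ.
        + exists (d, b * a) => /=; split=> //; rewrite !scalerA mulrC -!scalerA.
          by rewrite -scalerBr; apply: SZ.
      move=> d x' d0 [[d' a] /= [d'0 Sd]]; exists (d' * d, a) => /=.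
      by split; [move=> /domD[] | rewrite -scalerA].
    - move=> y Sy; exists (1, 0) => /=; split; first by apply/eqP; exact: oner_neq0.
      by rewrite scale1r scale0r subr0.
    - exists (1, 1) => /=; split; first by apply/eqP; exact: oner_neq0.
      by rewrite subrr.
  exists (a, d) => /=; split.
    by move=> a0; apply: nSm; apply: (satS d) => //; rewrite a0 scale0r subr0 in Sda.
  by rewrite -opprB; apply: submodN.
have [cd cdP] := boolp.choice (fun i => rank1 (e i)).
(* [c] is a common denominator: modulo [S], [c x] is a multiple of [m] for every generator [x],
   hence for every [x]. *)
pose c := \prod_i (cd i).1.
have c0 : c <> 0 by apply: domain_prod_neq0 => i; case: (cdP i).
have coord x : exists l, S (c *: x - l *: m).
  have /gen[a ->] : x \in predT by [].
  exists (\sum_i a i * ((\prod_(j | j != i) (cd j).1) * (cd i).2)).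
  rewrite scaler_sumr scaler_suml -sumrB; apply: submod_sum => // i.
  have -> : c *: (a i *: e i) - (a i * (\prod_(j | j != i) (cd j).1 * (cd i).2)) *: m
     = (a i * \prod_(j | j != i) (cd j).1) *: ((cd i).1 *: e i - (cd i).2 *: m).
    rewrite scalerBr !scalerA; congr (_ *: _ - _ *: _); last by rewrite mulrA.
    by rewrite /c (bigD1 i) //=; ring.
  by apply: SZ; case: (cdP i).
have [r rmax nrc] := jac c c0; have [[r0 rD rM] _ _] := rmax.
(* These are the [x] whose functional value lies in [r]. The value at [m] can only be [c], because
   [S] is saturated and misses [m], and [c] is outside [r]. *)
have [|||X [Xmax NX nXm]] := @hyperplane _ M
    [set x | exists l, r l /\ S (c *: x - l *: m)] r m _ rmax.
- split=> [|u v [k [rk Sk]] [l [rl Sl]]|b u [l [rl Sl]]].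
  + by exists 0; rewrite scaler0 scale0r subr0.
  + exists (k + l); split; first exact: rD.
    by rewrite scalerDr scalerDl opprD addrACA; apply: SD.
  + exists (b * l); split; first exact: rM.
    by rewrite !scalerA mulrC -!scalerA -scalerBr; apply: SZ.
- move=> a x ra; have [l Sl] := coord x; exists (a * l); split.
    by rewrite mulrC; apply: rM.
  by rewrite !scalerA mulrC -!scalerA -scalerBr; apply: SZ.
- move=> [l [rl]]; rewrite -scalerBl => Scl; apply: nSm; apply: satS Scl.
  by move=> /subr0_eq cl; apply: nrc; rewrite cl.
exists X; split=> // x Tx; apply: NX; exists 0; split=> //.
by rewrite scale0r subr0; apply/SZ/TS.
Qed.

(* s q contained in (p), with s outside q, says that p generates q locally
   at q. *)
Definition locally_principal (q : set D) : Prop :=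
  exists p s, [/\ q p, ~ q s & forall x, q x -> exists y, s * x = p * y].

(** The submodule of the [x] with [s x] in [N + p M] contains [N] and [q M]. It misses [m]: if
    [s m - p y] is in [N], then [p s m] being in [N] puts [p p y] there, hence [p y] by classical
    primeness, hence [s m], against [s] outside [q]. *)
Lemma max_submod_torsion (N : set M) m (q : set D) :
  cl_prime N -> ~ N m -> (forall a, q a <-> N (a *: m)) ->
  max_ideal q -> locally_principal q ->
  exists X, [/\ max_submod X, N `<=` X & ~ X m].
Proof.
move=> [sN _ Np] nNm qE qmax [p [s [qp nqs qlp]]]; have [N0 ND NZ] := sN.
have [|||X [Xmax NX nXm]] := @hyperplane _ M
    [set x | exists y, N (s *: x - p *: y)] q m _ qmax.
- split=> [|u v [y Ny] [z Nz]|b u [y Ny]].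
  + by exists 0; rewrite !scaler0 subr0.
  + by exists (y + z); rewrite !scalerDr opprD addrACA; apply: ND.
  + exists (b *: y); rewrite !scalerA mulrC [p * _]mulrC -!scalerA -scalerBr.
    exact: NZ.
- move=> a x /qlp[y sy]; exists (y *: x).
  by rewrite !scalerA sy subrr.
- move=> [y Ny].
  have Npy : N (p *: y).
    have : N ((p * p) *: y).
      have Nspm : N ((p * s) *: m) by rewrite mulrC -scalerA; apply/NZ/qE.
      by have := NZ p _ Ny; rewrite scalerBr !scalerA => /(submodB sN Nspm); rewrite subKr.
    by case/Np.
  apply: nqs; apply/qE; rewrite -(subrK (p *: y) (s *: m)); exact: ND.
exists X; split=> // x Nx; apply: NX; exists 0; rewrite scaler0 subr0; exact: NZ.
Qed.

Lemma fg_cl_Hilbert :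
  (forall c : D, c <> 0 -> exists2 r, max_ideal r & ~ r c) ->
  (forall q : set D, prime_ideal q -> (exists2 a, q a & a <> 0) ->
     max_ideal q /\ locally_principal q) ->
  finitely_generated M -> cl_Hilbert M.
Proof.
move=> jac ded fgM; apply/cl_HilbertP => N m Np nNm.
have [sN _ NP] := Np; have [N0 ND NZ] := sN.
have [[a Na a0]|tf] := pselect (exists2 a, N (a *: m) & a <> 0).
  have [||qmax qlp] := ded [set a | N (a *: m)].
  - split=> [||b c /NP //]; last by rewrite /= scale1r.
    split=> /= [|u v Nu Nv|b u Nu]; rewrite ?scale0r ?scalerDl -?scalerA //.
      exact: ND.
    exact: NZ.
  - by exists a.
  - exact: max_submod_torsion qmax qlp.
(* Here [(N : m) = 0]. The set is the preimage of the torsion part of [M / N], so it misses [m]. *)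
have [|||X [Xmax TX nXm]] :=
  @max_submod_saturated [set x | exists2 d, d <> 0 & N (d *: x)] m fgM jac.
- split=> [|u v [d d0 Nd] [e e0 Ne]|b u [d d0 Nd]].
  + by exists 1; [apply/eqP; exact: oner_neq0 | rewrite scaler0].
  + exists (d * e); first by move=> /domD[].
    by rewrite scalerDr {1}mulrC -!scalerA; apply: ND; apply: NZ.
  + by exists d => //; rewrite scalerA mulrC -scalerA; apply: NZ.
- move=> d x d0 [e e0]; rewrite scalerA => Ne; exists (e * d) => //.
  by move=> /domD[].
- by move=> [d d0 Nd]; apply: tf; exists d.
exists X; split=> // x Nx; apply: TX; exists 1; last by rewrite scale1r.
by apply/eqP; exact: oner_neq0.
Qed.

End DomainModules.

(** * Products of ideals and unique factorization *)

Section IdealProducts.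
Variable D : comNzRingType.
Implicit Types (p q A B C I J K P Q : set D) (s t : seq (set D)).

(* The ideal p + A B; working with it for a prime p amounts to multiplying
   ideals of D / p. *)
Definition mul_ideal p A B : set D :=
  [set x | forall K, ideal K -> p `<=` K ->
     (forall a b, A a -> B b -> K (a * b)) -> K x].

Definition prod_ideal p s : set D := foldr (mul_ideal p) setT s.

Lemma idealN I x : ideal I -> I x -> I (- x).
Proof. by case=> _ _ IM Ix; rewrite -mulN1r; apply: IM. Qed.

Lemma idealB I x y : ideal I -> I x -> I y -> I (x - y).
Proof. by move=> iI Ix Iy; case: (iI) => _ ID _; apply: ID => //; apply: idealN. Qed.

Lemma ideal_setT : ideal [set: D]. Proof. by []. Qed.

Lemma ideal_set0 : ideal [set (0 : D)].
Proof.
by split=> [//|u v -> ->|a u ->]; rewrite /= ?addr0 ?mulr0.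
Qed.

Lemma set0_subI I : ideal I -> [set 0] `<=` I.
Proof. by case=> I0 _ _ x ->. Qed.

Lemma mul_ideal_ideal p A B : ideal (mul_ideal p A B).
Proof.
split=> [K [] //|u v uI vI K iK pK ABK|a u uI K iK pK ABK].
  by case: (iK) => _ KD _; apply: KD; [apply: uI|apply: vI].
by case: (iK) => _ _ KM; apply: KM; apply: uI.
Qed.

Lemma mul_ideal_in p A B a b : A a -> B b -> mul_ideal p A B (a * b).
Proof. by move=> Aa Bb K _ _; apply. Qed.

Lemma mul_ideal_sup p A B : p `<=` mul_ideal p A B.
Proof. by move=> x px K _ pK _; apply: pK. Qed.

Lemma mul_ideal_sub p A B K : ideal K -> p `<=` K ->
  (forall a b, A a -> B b -> K (a * b)) -> mul_ideal p A B `<=` K.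
Proof. by move=> iK pK ABK x; apply. Qed.

Lemma mul_idealC p A B : mul_ideal p A B = mul_ideal p B A.
Proof.
have H A' B' : mul_ideal p A' B' `<=` mul_ideal p B' A'.
  apply: mul_ideal_sub; [exact: mul_ideal_ideal | exact: mul_ideal_sup|].
  by move=> a b Aa Bb; rewrite mulrC; apply: mul_ideal_in.
by apply/seteqP; split; apply: H.
Qed.

Lemma mul_ideal_subl p A B : ideal A -> p `<=` A -> mul_ideal p A B `<=` A.
Proof. by move=> iA pA; apply: mul_ideal_sub => // a b Aa _; rewrite mulrC; case: iA => _ _; apply. Qed.

Lemma mul_idealS p p' A A' B B' : p `<=` p' -> A `<=` A' -> B `<=` B' ->
  mul_ideal p A B `<=` mul_ideal p' A' B'.
Proof.
move=> pp AA BB; apply: mul_ideal_sub; first exact: mul_ideal_ideal.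
  by apply: (subset_trans pp); apply: mul_ideal_sup.
by move=> a b /AA Aa /BB Bb; apply: mul_ideal_in.
Qed.

Lemma mul_idealTl p A : ideal A -> p `<=` A -> mul_ideal p setT A = A.
Proof.
move=> iA pA; apply/seteqP; split; first by rewrite mul_idealC; apply: mul_ideal_subl.
by move=> x Ax; rewrite -[x]mul1r; apply: mul_ideal_in.
Qed.

Lemma mul_idealA p A B C : ideal p ->
  mul_ideal p A (mul_ideal p B C) = mul_ideal p (mul_ideal p A B) C.
Proof.
move=> [_ _ pM].
have H A' B' C' : mul_ideal p (mul_ideal p A' B') C' `<=` mul_ideal p A' (mul_ideal p B' C').
  have iR := mul_ideal_ideal p A' (mul_ideal p B' C'); have [R0 RD RM] := iR.
  apply: mul_ideal_sub => //; first exact: mul_ideal_sup.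
  move=> d c ABd Cc; apply: (ABd [set d | mul_ideal p A' (mul_ideal p B' C') (d * c)]).
  - split=> /= [|u v ru rv|a u ru]; rewrite ?mul0r ?mulrDl -?mulrA //.
      exact: RD.
    exact: RM.
  - by move=> x px /=; apply: mul_ideal_sup; rewrite mulrC; apply: pM.
  - by move=> a b Aa Bb /=; rewrite -mulrA; do 2?apply: mul_ideal_in.
apply/seteqP; split; last exact: H.
rewrite mul_idealC [mul_ideal p B C]mul_idealC.
by rewrite [mul_ideal p _ C]mul_idealC [mul_ideal p A B]mul_idealC; apply: H.
Qed.

Lemma prod_ideal_ideal p s : ideal (prod_ideal p s).
Proof. by case: s => [|A s]; [exact: ideal_setT | exact: mul_ideal_ideal]. Qed.

Lemma prod_ideal_sup p s : p `<=` prod_ideal p s.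
Proof. by case: s => [|A s] //=; exact: mul_ideal_sup. Qed.

Lemma prod_ideal_cat p s t : ideal p ->
  prod_ideal p (s ++ t) = mul_ideal p (prod_ideal p s) (prod_ideal p t).
Proof.
move=> ip; elim: s => [|A s IH] /=; last by rewrite IH mul_idealA.
by rewrite mul_idealTl //; [exact: prod_ideal_ideal | exact: prod_ideal_sup].
Qed.

Lemma prod_ideal_perm p s t : ideal p -> perm_eq s t ->
  prod_ideal p s = prod_ideal p t.
Proof.
move=> ip st.
have rot s1 A s2 : prod_ideal p (s1 ++ A :: s2) = prod_ideal p (A :: s1 ++ s2).
  by elim: s1 => //= B s1 ->; rewrite /= !mul_idealA // [mul_ideal p B A]mul_idealC.
elim: s t st => [|A s IH] t; first by rewrite perm_sym => /perm_nilP ->.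
move=> st; have At : A \in t by rewrite -(perm_mem st) mem_head.
case/splitPr: At st => t1 t2 st; rewrite (rot t1 A t2) /=; congr mul_ideal.
by apply: IH; rewrite -(perm_cons A) (perm_trans st) // perm_catC /= perm_cons perm_catC.
Qed.

Lemma prod_ideal_mem p s P :
  ideal P -> p `<=` P -> P \in s -> prod_ideal p s `<=` P.
Proof.
move=> iP pP; elim: s => //= Q s IH; rewrite in_cons => /predU1P[<-|/IH sP].
  exact: mul_ideal_subl.
apply: subset_trans sP; rewrite mul_idealC; apply: mul_ideal_subl.
  exact: prod_ideal_ideal.
exact: prod_ideal_sup.
Qed.

Lemma prime_prod_ideal p s P :
  prime_ideal P -> prod_ideal p s `<=` P -> exists2 Q, Q \in s & Q `<=` P.
Proof.
move=> [iP nP1 Pp]; elim: s => [/(_ 1 I)|Q s IH] //= QsP.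
have [sP|/existsNP[b /not_implyP[sb nPb]]] := pselect (prod_ideal p s `<=` P).
  by have [Q' Q's Q'P] := IH sP; exists Q' => //; rewrite in_cons Q's orbT.
exists Q; first exact: mem_head.
move=> a Qa; have /Pp[] // : P (a * b) by apply: QsP; apply: mul_ideal_in.
Qed.

(** A product formed modulo [p] is no more than [p] plus the product formed in [D], which lets
    factorizations in [D] be read modulo [p]. *)
Lemma prod_idealE p s x : ideal p ->
  prod_ideal p s x -> exists2 y, prod_ideal [set 0] s y & p (x - y).
Proof.
move=> ip; have [p0 pD pM] := ip.
elim: s x => [|P s IH] x /=; first by move=> _; exists x; rewrite ?subrr.
have [M0 MD MM] := mul_ideal_ideal [set 0] P (prod_ideal [set 0] s).
apply: (mul_ideal_sub
  (K := [set x | exists2 y, mul_ideal [set 0] P (prod_ideal [set 0] s) y & p (x - y)])).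
- split=> [|u v [y My py] [z Mz pz]|a u [y My py]].
  + by exists 0; rewrite ?subrr.
  + by exists (y + z); [apply: MD | rewrite opprD addrACA; apply: pD].
  + by exists (a * y); [apply: MM | rewrite -mulrBr; apply: pM].
- by move=> z pz; exists 0; rewrite ?subr0.
- move=> a b Pa /IH[y sy pby]; exists (a * y); first exact: mul_ideal_in.
  by rewrite -mulrBr; apply: pM.
Qed.

Lemma prod_idealS p p' s : p `<=` p' -> prod_ideal p s `<=` prod_ideal p' s.
Proof. by move=> pp; elim: s => //= P s IH; apply: mul_idealS. Qed.

Lemma minimal_mem s P0 : P0 \in s ->
  exists2 P, P \in s & forall Q, Q \in s -> Q `<=` P -> P `<=` Q.
Proof.
elim: s P0 => // P1 [|P2 s] IH P0 _.
  by exists P1; rewrite ?mem_head // => Q; rewrite inE => /eqP ->.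
have [P Ps Pmin] := IH P2 (mem_head _ _).
have [P1P|nP1P] := pselect (P1 `<=` P).
  exists P1; first exact: mem_head.
  move=> Q; rewrite in_cons => /predU1P[->|Qs] // QP1.
  by apply: (subset_trans P1P); apply: Pmin => //; apply: (subset_trans QP1).
exists P; first by rewrite in_cons Ps orbT.
by move=> Q; rewrite in_cons => /predU1P[->|Qs] //; apply: Pmin.
Qed.

Lemma prod_ideal_setT p s : (forall P, P \in s -> prime_ideal P /\ p `<=` P) ->
  prod_ideal p s 1 -> s = [::].
Proof.
case: s => // P s sP s1; have [[iP nP1 _] pP] := sP P (mem_head _ _).
by exfalso; apply: nP1; apply: (prod_ideal_mem iP pP (mem_head _ _)) s1.
Qed.

(* Unique factorization, read modulo the prime p: an invertible product of
   prime ideals determines its factors. *)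
Lemma prod_ideal_uniq p s t J c : prime_ideal p ->
  (forall P, P \in s -> prime_ideal P /\ p `<=` P) ->
  (forall P, P \in t -> prime_ideal P /\ p `<=` P) ->
  prod_ideal p s = prod_ideal p t ->
  ~ p c -> mul_ideal p J (prod_ideal p s) c ->
  (forall x, mul_ideal p J (prod_ideal p s) x -> exists b, p (x - c * b)) ->
  perm_eq s t.
Proof.
move=> [ip np1 pp] sP tP st npc.
have [n] := ubnP (size s); elim: n s t J sP tP st => // n IH s t J sP tP st szs Jc Jdiv.
have [s0|[P0 P0s]] : s = [::] \/ exists P0, P0 \in s.
  by case: (s) => [|P0 s']; [left | right; exists P0; apply: mem_head].
  rewrite s0 in st *; suff -> : t = [::] by [].
  by apply: (prod_ideal_setT tP); rewrite -st.
(* A minimal factor [P] of [s] contains a factor [Q] of [t], which contains a factor of [s];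
   minimality forces [P = Q], and this common factor is removed from both lists. *)
have [P Ps Pmin] := minimal_mem P0s; have [Pprime pP] := sP P Ps.
have [Q Qt QP] : exists2 Q, Q \in t & Q `<=` P.
  apply: (@prime_prod_ideal p) => //; rewrite -st.
  by apply: prod_ideal_mem => //; case: Pprime.
have [Qprime pQ] := tP Q Qt.
have [P' P's P'Q] : exists2 P', P' \in s & P' `<=` Q.
  apply: (@prime_prod_ideal p) => //; rewrite st.
  by apply: prod_ideal_mem => //; case: Qprime.
have PQ : P = Q.
  apply/seteqP; split=> //; apply: (subset_trans _ P'Q); apply: Pmin => //.
  exact: (subset_trans P'Q).
rewrite -{}PQ in Qt; clear Q QP Qprime pQ P'Q.
have sPs := perm_to_rem Ps; have tPt := perm_to_rem Qt.
set s' := rem P s in sPs; set t' := rem P t in tPt.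
have sE : mul_ideal p P (prod_ideal p s') = prod_ideal p s.
  by rewrite (prod_ideal_perm ip sPs).
have tE : mul_ideal p P (prod_ideal p t') = prod_ideal p t.
  by rewrite (prod_ideal_perm ip tPt).
rewrite (perm_trans sPs) // perm_sym (perm_trans tPt) // perm_cons perm_sym.
(* Cancellation of [P]: [J A P] is generated by [c] modulo [p], and [P A = P B], so [c x] lies in
   [J A P A = J A P B], hence in [c B + p]; since [p] is prime, [c] drops out. *)
have cancel A B : ideal B -> p `<=` B ->
    mul_ideal p P A = mul_ideal p P B -> mul_ideal p P A = prod_ideal p s -> A `<=` B.
  move=> iB pB PAB PA x Ax; have [B0 BD BM] := iB.
  have KP : mul_ideal p (mul_ideal p J A) P = mul_ideal p J (prod_ideal p s).
    by rewrite -mul_idealA // [mul_ideal p A P]mul_idealC PA.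
  have : mul_ideal p (mul_ideal p (mul_ideal p J A) P) B (c * x).
    rewrite -mul_idealA // -PAB mul_idealA // KP; exact: mul_ideal_in.
  have [p0 pD pM] := ip.
  case/(_ [set y | exists2 b, B b & p (y - c * b)]).
  - split=> [|u v [b Bb pb] [d Bd pd]|a u [b Bb pb]].
    + by exists 0; rewrite ?mulr0 ?subrr.
    + by exists (b + d); [apply: BD | rewrite mulrDr opprD addrACA; apply: pD].
    + by exists (a * b); [apply: BM | rewrite mulrCA -mulrBr; apply: pM].
  - by move=> y py; exists 0; rewrite ?mulr0 ?subr0.
  - rewrite KP => d b /Jdiv[e pe] Bb; exists (e * b); first exact: BM.
    by rewrite mulrA -mulrBl mulrC; apply: pM.
  - move=> b Bb; rewrite -mulrBr => /pp[//|pxb].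
    by rewrite -(subrK b x); apply: BD => //; apply: pB.
have prodE : prod_ideal p s' = prod_ideal p t'.
  apply/seteqP; split; apply: cancel.
  - exact: prod_ideal_ideal.
  - exact: prod_ideal_sup.
  - by rewrite sE tE.
  - exact: sE.
  - exact: prod_ideal_ideal.
  - exact: prod_ideal_sup.
  - by rewrite sE tE.
  - by rewrite tE.
(* The removed factor moves into [J], so [c] still generates the product modulo [p]. *)
apply: (IH s' t' (mul_ideal p J P)) => //.
- by move=> Q /mem_rem; apply: sP.
- by move=> Q /mem_rem; apply: tP.
- by rewrite size_rem // -ltnS (leq_trans _ szs) // prednK //; case: (s) Ps.
- by rewrite -mul_idealA // sE.
- by rewrite -mul_idealA // sE.
Qed.

End IdealProducts.

(** * Nonzero primes of a domain with prime factorization *)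

Section Dedekind.
Variable D : comNzRingType.
Hypothesis domD : forall a b : D, a * b = 0 -> a = 0 \/ b = 0.
Implicit Types (p q I J P : set D) (s t : seq (set D)).

Definition prime_factorization : Prop :=
  forall I, ideal I -> ~ I 1 ->
    exists2 s, forall P, P \in s -> prime_ideal P & I = prod_ideal [set 0] s.

Lemma domain_cancel (c x y : D) : c <> 0 -> c * x = c * y -> x = y.
Proof.
move=> c0 /eqP; rewrite -subr_eq0 -mulrBr => /eqP/domD[//|].
exact: subr0_eq.
Qed.

Lemma ideal_principal (a : D) : ideal [set x | exists b, x = a * b].
Proof.
split=> [|u v [b ->] [d ->]|e u [b ->]]; first by exists 0; rewrite mulr0.
  by exists (b + d); rewrite mulrDr.
by exists (e * b); rewrite mulrCA.
Qed.

(* If p + (a) is proper, unique factorization modulo p forces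
   p + (a^2) = (p + (a))^2, so that p is contained in p (p + (a)), and p can be
   cancelled. *)
Lemma invertible_prime_max p J c : prime_factorization -> prime_ideal p ->
  c <> 0 -> mul_ideal [set 0] J p c ->
  (forall x, mul_ideal [set 0] J p x -> exists b, x = c * b) ->
  max_ideal p.
Proof.
move=> fact pprime c0 Jc Jdiv; have [ip np1 pp] := pprime; have [p0 pD pM] := ip.
split=> // a npa; pose I1 := [set y | exists b, p (y - b * a)].
have iI1 : ideal I1 := ideal_adjoin a ip.
pose I2 := [set y | exists b, p (y - b * (a * a))].
have iI2 : ideal I2 := ideal_adjoin (a * a) ip.
have pI1 : p `<=` I1 by move=> x px; exists 0; rewrite mul0r subr0.
have pI2 : p `<=` I2 by move=> x px; exists 0; rewrite mul0r subr0.
have I21 : I2 `<=` I1 by move=> x [b px]; exists (b * a); rewrite -mulrA.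
apply: contrapT => nI1.
have [s sP sE] := fact I1 iI1 nI1.
have [t tP tE] := fact I2 iI2 (fun h => nI1 (I21 _ h)).
have sub0 I : ideal I -> [set 0] `<=` I := @set0_subI D I.
have prodpE u I : ideal I -> p `<=` I -> I = prod_ideal [set 0] u -> prod_ideal p u = I.
  move=> iI pI IE; apply/seteqP; split=> x.
    move=> /(prod_idealE ip)[y]; rewrite -IE => Iy /pI Ixy.
    by rewrite -(subrK y x); case: iI => _ ID _; apply: ID.
  by rewrite IE; apply: prod_idealS; apply: sub0.
have sp P : P \in s -> prime_ideal P /\ p `<=` P.
  move=> Ps; split; first exact: sP.
  apply: (subset_trans pI1); rewrite sE.
  by have [iP _ _] := sP P Ps; apply: prod_ideal_mem => //; apply: sub0.
have tp P : P \in t -> prime_ideal P /\ p `<=` P.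
  move=> Pt; split; first exact: tP.
  apply: (subset_trans pI2); rewrite tE.
  by have [iP _ _] := tP P Pt; apply: prod_ideal_mem => //; apply: sub0.
(* Modulo [p], [I2] is the square of [I1]. *)
have ssE : prod_ideal p (s ++ s) = I2.
  rewrite prod_ideal_cat // (prodpE s I1) //; apply/seteqP; split.
    apply: mul_ideal_sub => // x y [b pb] [d pd]; exists (b * d).
    have -> : x * y - b * d * (a * a) = y * (x - b * a) + (b * a) * (y - d * a) by ring.
    by apply: pD; apply: pM.
  move=> x [b pb]; rewrite -(subrK (b * (a * a)) x).
  have [_ MD MM] := mul_ideal_ideal p I1 I1; apply: MD.
    exact: mul_ideal_sup.
  by apply: MM; apply: mul_ideal_in; exists 1; rewrite mul1r subrr.
have I2aa : I2 (a * a) by exists 1; rewrite mul1r subrr.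
(* Modulo [p], [I2] is generated by [a a], so unique factorization applies with [J] the whole
   ring. *)
have st : perm_eq (s ++ s) t.
  apply: (@prod_ideal_uniq D p (s ++ s) t setT (a * a)) => //.
  - by move=> P; rewrite mem_cat orbb; apply: sp.
  - by rewrite ssE (prodpE t I2).
  - by case/pp.
  - by rewrite ssE mul_idealTl.
  - by rewrite ssE mul_idealTl // => x [b pb]; exists b; rewrite mulrC.
(* The two lists consist of the same ideals of [D], so the equality now holds in [D] and not only
   modulo [p]. *)
have I2E : I2 = mul_ideal [set 0] I1 I1.
  rewrite tE -(prod_ideal_perm (ideal_set0 D) st) prod_ideal_cat -?sE //.
  exact: ideal_set0.
have [M0 MD MM] := mul_ideal_ideal [set 0] p I1.
(* An element of [I1 I1] has the form [y + a z] with [y] in [p I1]. If it lies in [p], then so does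
   [a z], hence [z], and [a z] is in [p I1] too. *)
have pI : p `<=` mul_ideal [set 0] p I1.
  move=> x px; have : I2 x by apply: pI2.
  rewrite I2E => /(_ [set x | exists y z, mul_ideal [set 0] p I1 y /\ x = y + a * z]).
  case.
  - split=> [|u v [y [z [My ->]]] [y' [z' [My' ->]]]|e u [y [z [My ->]]]].
    + by exists 0, 0; rewrite mulr0 addr0.
    + by exists (y + y'), (z + z'); split; [apply: MD | rewrite mulrDr addrACA].
    + by exists (e * y), (e * z); split; [apply: MM | rewrite mulrDr mulrCA].
  - by move=> _ ->; exists 0, 0; rewrite mulr0 addr0.
  - move=> u v [b pb] [d pd].
    exists ((u - b * a) * (v - d * a)), (b * v + d * u - b * d * a); split.
      by apply: mul_ideal_in => //; apply: pI1.
    by ring.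
  - move=> y [z [My xE]]; rewrite xE; apply: (MD) => //.
    have : p (a * z).
      rewrite -(addKr y (a * z)) -xE addrC; apply: idealB => //.
      exact: (mul_ideal_subl ip (sub0 _ ip)) My.
    case/pp => // pz; rewrite mulrC; apply: mul_ideal_in => //.
    by exists 1; rewrite mul1r subrr.
(* [c] lies in [J p], hence in [J p I1], hence in [c I1]. *)
have [w I1w cw] : exists2 w, I1 w & c = c * w.
  have : mul_ideal [set 0] (mul_ideal [set 0] J p) I1 c.
    rewrite -mul_idealA; last exact: ideal_set0.
    exact: (mul_idealS (subset_refl _) (subset_refl _) pI) Jc.
  apply: (mul_ideal_sub (K := [set x | exists2 w, I1 w & x = c * w])).
  - have [I10 I1D I1M] := iI1.
    split=> [|u v [y Iy ->] [z Iz ->]|e u [y Iy ->]].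
    + by exists 0; rewrite ?mulr0.
    + by exists (y + z); [apply: I1D | rewrite mulrDr].
    + by exists (e * y); [apply: I1M | rewrite mulrCA].
  - by move=> _ ->; exists 0; [case: iI1 | rewrite mulr0].
  - move=> d v /Jdiv[b ->] Iv; exists (b * v); last by rewrite mulrA.
    by case: iI1 => _ _; apply.
apply: nI1; suff -> : 1 = w by [].
by apply: (domain_cancel c0); rewrite mulr1.
Qed.

(** Some prime factor [P] of [(a)] lies in [q]. It is invertible with cofactor [J], hence maximal
    and equal to [q]. From [J P = (a)] come [j] and [x] with [j x = a u] and [u] outside [P]; then
    [x] generates [P] locally. *)
Lemma dedekind_prime q a : prime_factorization -> prime_ideal q -> q a -> a <> 0 ->
  max_ideal q /\ locally_principal q.
Proof.
move=> fact qprime qa a0; have [iq nq1 qp] := qprime; have [q0 qD qM] := iq.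
have aq : [set x | exists b, x = a * b] `<=` q.
  by move=> _ [b ->]; rewrite mulrC; apply: qM.
have [s sP sE] := fact _ (ideal_principal a) (fun h => nq1 (aq _ h)).
have [P Ps Pq] : exists2 P, P \in s & P `<=` q.
  by apply: (@prime_prod_ideal D [set 0]) => //; rewrite -sE.
have JP : mul_ideal [set 0] (prod_ideal [set 0] (rem P s)) P = [set x | exists b, x = a * b].
  by rewrite sE (prod_ideal_perm (ideal_set0 D) (perm_to_rem Ps)) mul_idealC.
set J := prod_ideal _ _ in JP.
have Ja : mul_ideal [set 0] J P a by rewrite JP; exists 1; rewrite mulr1.
have Jdiv x : mul_ideal [set 0] J P x -> exists b, x = a * b by rewrite JP.
have Pmax : max_ideal P by apply: (invertible_prime_max fact (sP P Ps) a0 Ja).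
have qP : q = P.
  apply/seteqP; split=> // x qx; apply: contrapT => nPx; apply: nq1.
  have [_ _ /(_ x nPx)[b Pb]] := Pmax; rewrite -(subrK (b * x) 1).
  by apply: qD; [apply: Pq | apply: qM].
rewrite qP; split=> //; have [iP nP1 Pp] := sP P Ps; have [P0 PD PM] := iP.
(* Otherwise [J P] would lie in [a P], and [a] in [J P] would give [1] in [P]. *)
have [j [x [u [Jj Px jx nPu]]]] : exists j x u, [/\ J j, P x, j * x = a * u & ~ P u].
  apply: contrapT => none; apply: nP1.
  have [|||u Pu au] := Ja [set y | exists2 u, P u & y = a * u].
  - split=> [|y z [u Pu ->] [v Pv ->]|e y [u Pu ->]].
    + by exists 0; rewrite ?mulr0.
    + by exists (u + v); [apply: PD | rewrite mulrDr].
    + by exists (e * u); [apply: PM | rewrite mulrCA].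
  - by move=> _ ->; exists 0; rewrite ?mulr0.
  - move=> j x Jj Px; have [u jx] := Jdiv _ (mul_ideal_in (p := [set 0]) Jj Px).
    exists u => //; apply: contrapT => nPu; apply: none; by exists j, x, u.
  suff -> : 1 = u by [].
  by apply: (domain_cancel a0); rewrite mulr1.
exists x, u; split=> // y Py.
have [v jy] := Jdiv _ (mul_ideal_in (p := [set 0]) Jj Py); exists v.
by apply: (domain_cancel a0); rewrite [RHS]mulrCA mulrA -jx -jy; ring.
Qed.

End Dedekind.

(** * Noetherian domains D with D + D a cl.Hilbert module *)

Section QuotientMap.
Variables (R : comNzRingType) (P : idealr R).

Definition quot_map : {rmorphism R -> {ideal_quot P}} := \pi_{ideal_quot P}%qT.

Lemma quot_map_surj y : exists x, quot_map x = y.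
Proof. by exists (repr y); rewrite /quot_map /= reprK. Qed.

Lemma quot_map_eq0 x : quot_map x = 0 <-> x \in P.
Proof.
have -> : (0 : {ideal_quot P}) = quot_map 0 by rewrite raddf0.
by have := Quotient.idealrBE P x 0; rewrite subr0 => ->; split=> /eqP.
Qed.
End QuotientMap.

(** Modulo [q] the matrix is scalar, with determinant [s ^ n] in a domain. *)
Lemma det_mod_prime (D : comNzRingType) (q : set D) (n : nat) (s : D) (A : 'M[D]_n) :
  prime_ideal q -> ~ q s -> (forall i j, q (A i j)) -> ~ q (\det (s%:M - A)).
Proof.
move=> /prime_ideal_prime_idealr[Q QE] nqs qA.
have qQ x : q x <-> quot_map Q x = 0 by rewrite quot_map_eq0 -QE.
rewrite qQ -det_map_mx map_mxB map_scalar_mx /=.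
have -> : map_mx (quot_map Q) A = 0.
  by apply/matrixP=> i j; rewrite !mxE; apply/qQ.
rewrite subr0 det_scalar => sn; apply/nqs/qQ; move: sn.
elim: n {A qA} => [|n IH]; first by move/eqP; rewrite expr0 oner_eq0.
by rewrite exprS => /Quotient.rquot_IdomainAxiom/orP[/eqP|/eqP/IH].
Qed.

Section NoetherianDomain.
Variable D : comNzRingType.
Hypothesis domD : forall a b : D, a * b = 0 -> a = 0 \/ b = 0.
Implicit Types (p q I J P : set D).

Definition generated_by I (n : nat) (e : 'I_n -> D) : Prop :=
  forall x, I x <-> exists c : 'I_n -> D, x = \sum_i c i * e i.

Definition ideals_fg : Prop :=
  forall I, ideal I -> exists (n : nat) (e : 'I_n -> D), generated_by I e.

Lemma generated_by_mem I n (e : 'I_n -> D) i : generated_by I e -> I (e i).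
Proof.
move=> gen; apply/gen; exists (fun j => (j == i)%:R).
rewrite (bigD1 i) //= eqxx mul1r big1 ?addr0 // => j /negPf ->; exact: mul0r.
Qed.

(** The finitely many generators of the union of a chain lie in one member, so the union is that
    member and Zorn's lemma applies. *)
Lemma ideals_fg_max (C : set (set D)) I0 : ideals_fg ->
  (forall I, C I -> ideal I) -> C I0 ->
  exists I, [/\ C I, I0 `<=` I & forall J, C J -> I `<=` J -> J `<=` I].
Proof.
move=> fg Cideal CI0; apply: Zorn_above => // F FC [X0 FX0] Ftot.
have iU : ideal (\bigcup_(X in F) X).
  apply: (@submod_bigcup D D^o F) => //; first by exists X0.
  by move=> X /FC/Cideal.
have [n [e gen]] := fg _ iU.
have [X FX Xe] : exists2 X, F X & forall x, x \in codom e -> X x.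
  have : forall x, x \in codom e -> (\bigcup_(X in F) X) x.
    by move=> _ /codomP[i ->]; apply: generated_by_mem gen.
  elim: (codom e) => [|x s IH] sU; first by exists X0.
  have [|X FX Xs] := IH; first by move=> y ys; apply: sU; rewrite in_cons ys orbT.
  have [Y FY Yx] := sU x (mem_head _ _).
  have [XY|YX] := Ftot X Y FX FY.
    by exists Y => // y; rewrite in_cons => /predU1P[->|/Xs/XY].
  by exists X => // y; rewrite in_cons => /predU1P[->|/Xs] //; apply: YX.
suff -> : \bigcup_(X in F) X = X by apply: FC.
apply/seteqP; split=> x; last by exists X.
move=> /gen[c ->]; have iX := Cideal _ (FC _ FX).
apply: (@submod_sum D D^o X) => // i; case: iX => _ _; apply.
exact/Xe/codom_f.
Qed.

(** Determinant trick: [s] acts on the generators as a matrix [A] over [q], so [det (s - A)] kills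
    them; it is outside [q], hence nonzero. *)
Lemma nakayama q I s : ideals_fg -> prime_ideal q -> ideal I -> ~ q s ->
  (forall x, I x -> mul_ideal [set 0] q I (s * x)) ->
  forall x, I x -> x = 0.
Proof.
move=> fg qprime iI nqs sI; have [n [e gen]] := fg I iI.
have [[q0 qD qM] _ _] := qprime.
have coef x : I x -> exists c : 'I_n -> D,
    (forall i, q (c i)) /\ s * x = \sum_i c i * e i.
  move=> /sI /(_ [set y | exists c : 'I_n -> D,
    (forall i, q (c i)) /\ y = \sum_i c i * e i]); apply.
  - split=> [|u v [c [qc ->]] [d [qd ->]]|a u [c [qc ->]]].
    + by exists (fun=> 0); split=> //; rewrite big1 // => i _; rewrite mul0r.
    + exists (fun i => c i + d i); split=> [i|]; first exact: qD.
      by rewrite -big_split; apply: eq_bigr => i _; rewrite mulrDl.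
    + exists (fun i => a * c i); split=> [i|]; first exact: qM.
      by rewrite big_distrr; apply: eq_bigr => i _; rewrite -mulrA.
  - by move=> _ ->; exists (fun=> 0); split=> //; rewrite big1 // => i _; rewrite mul0r.
  - move=> a y qa /gen[c ->]; exists (fun i => a * c i); split=> [i|].
      by rewrite mulrC; apply: qM.
    by rewrite big_distrr; apply: eq_bigr => i _; rewrite /= mulrA.
have [c cP] := boolp.choice (fun i => coef (e i) (generated_by_mem i gen)).
pose A : 'M[D]_n := \matrix_(i, j) c i j; pose E := \col_i e i.
have AE : (s%:M - A) *m E = 0.
  apply/matrixP=> i k; rewrite mulmxBl mul_scalar_mx !mxE (cP i).2.
  by apply/eqP; rewrite subr_eq0; apply/eqP/eq_bigr => j _; rewrite !mxE.
have ndet : ~ q (\det (s%:M - A)).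
  by apply: det_mod_prime => // i j; rewrite mxE; case: (cP i).
have e0 i : e i = 0.
  have /matrixP/(_ i 0) : \det (s%:M - A) *: E = 0.
    by rewrite -mul_scalar_mx -mul_adj_mx -mulmxA AE mulmx0.
  by rewrite !mxE => /domD[d0|//]; case: ndet; rewrite d0.
by move=> x /gen[d ->]; rewrite big1 // => i _; rewrite e0 mulr0.
Qed.

(* With I = (a : b) and L = {(x, y) | a y = b x}, the elements of L lying in
   q L locally at q form a classical prime submodule; by Nakayama it is not L,
   and a maximal submodule avoiding some (x, y) in L forces x or y out of q. *)
Lemma free2_proportional (a b : D) q : ideals_fg -> free2_cl_Hilbert D ->
  prime_ideal q -> a <> 0 ->
  exists x y, a * y = b * x /\ (~ q x \/ ~ q y).
Proof.
move=> fg /cl_HilbertP hilb qprime a0; have [[q0 qD qM] nq1 qp] := qprime.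
pose I := [set x | exists y, a * y = b * x].
have iI : ideal I.
  split=> [|u v [x xu] [y yv]|c u [x xu]].
  - by exists 0; rewrite !mulr0.
  - by exists (x + y); rewrite !mulrDr xu yv.
  - by exists (c * x); rewrite mulrCA xu mulrCA.
have [QI0 QID QIM] := mul_ideal_ideal [set 0] q I.
have [n [e gen]] := fg I iI.
(* Otherwise a product of elements outside [q] carries all of [I] into [q I], and Nakayama makes [I]
   zero, although [a] is in [I]. *)
have [x0 Ix0 x0P] : exists2 x, I x & forall s, ~ q s -> ~ mul_ideal [set 0] q I (s * x).
  apply: contrapT => none; apply: a0.
  have loc i : exists s, ~ q s /\ mul_ideal [set 0] q I (s * e i).
    apply: contrapT => noi; apply: none; exists (e i); first exact: generated_by_mem.
    by move=> s nqs Is; apply: noi; exists s.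
  have [s sP] := boolp.choice loc.
  apply: (@nakayama q I (\prod_i s i)) => //; last by exists b; rewrite mulrC.
    apply: (big_ind (fun x => ~ q x)) => // [u v nqu nqv /qp[]//|i _].
    by case: (sP i).
  move=> x /gen[c ->]; rewrite big_distrr.
  apply: (@submod_sum D D^o _) => [|i]; first exact: mul_ideal_ideal.
  rewrite (bigD1 i) //=.
  have -> : s i * (\prod_(j | j != i) s j) * (c i * e i) =
     (\prod_(j | j != i) s j * c i) * (s i * e i) by ring.
  by apply: QIM; case: (sP i).
have [y0 xy0] := Ix0.
pose N := [set z : D^o * D^o | a * z.2 = b * z.1 /\
  exists2 s, ~ q s & mul_ideal [set 0] q I (s * z.1)].
have sN : submod N.
  split=> [|u v [uL [s nqs su]] [vL [t nqt tv]]|c u [uL [s nqs su]]].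
  - by split; [rewrite /= !mulr0 | exists 1; rewrite /= ?mulr0].
  - split; first by rewrite /= !mulrDr uL vL.
    exists (s * t); first by case/qp.
    rewrite /= mulrDr {1}[s * t]mulrC -!mulrA; apply: QID; exact: QIM.
  - split; first by rewrite /= /GRing.scale /= mulrCA uL mulrCA.
    by exists s => //=; rewrite /GRing.scale /= mulrCA; apply: QIM.
have qN (c : D) (z : D^o * D^o) : q c -> a * z.2 = b * z.1 -> N (c *: z).
  move=> qc zL; split=> /=; rewrite /GRing.scale /=; first by rewrite mulrCA zL mulrCA.
  exists 1; rewrite // mul1r; apply: mul_ideal_in => //.
  by exists z.2.
have nN0 : ~ N (x0, y0) by case=> _ [s nqs] /=; apply: x0P.
have [|X [[sX _ Xmax] NX nX0]] := hilb N (x0, y0) _ nN0.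
  split=> //; first by exists (x0, y0).
  have [N0 ND NZ] := sN.
  move=> c d z [/= cdL [s nqs sz]].
  (* Zero scalars aside, [c d z] in [N] forces [a z.2 = b z.1]. A scalar in [q] then sends [z] into
     [N]; if neither is in [q], the factor [s c d] shows that [z] is in [N]. *)
  have [qc|nqc] := pselect (q c).
    have [d0|d0] := pselect (d = 0); first by right; rewrite d0 scale0r.
    have [c0|c0] := pselect (c = 0); first by left; rewrite c0 scale0r.
    left; apply: qN => //.
    have cd0 : c * d <> 0 by case/domD.
    by apply: (domain_cancel domD cd0); move: cdL; rewrite /GRing.scale /= mulrCA => ->; rewrite mulrCA.
  have [d0|d0] := pselect (d = 0); first by right; rewrite d0 scale0r.
  have c0 : c <> 0 by move=> c0; apply: nqc; rewrite c0.
  have cd0 : c * d <> 0 by case/domD.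
  have zL : a * z.2 = b * z.1.
    by apply: (domain_cancel domD cd0); move: cdL; rewrite /GRing.scale /= mulrCA => ->; rewrite mulrCA.
  right; have [qd|nqd] := pselect (q d); first exact: qN.
  apply: NZ; split=> //; exists (s * (c * d)); first by case/qp => // /qp[].
  by rewrite -mulrA.
exists x0, y0; split=> //; apply: contrapT => /not_orP[/contrapT qx0 /contrapT qy0].
have [X0 XD XZ] := sX.
(* Modulo [X], the basis vectors are [c] and [d] times [(x0, y0)], so [(x0, y0)] is [t] times
   itself; with [t] in [q], this multiple lies in [N]. *)
have [c Xc] := Xmax _ nX0 (1, 0); have [d Xd] := Xmax _ nX0 (0, 1).
apply: nX0; pose t := x0 * c + y0 * d.
have qt : q t by apply: qD; rewrite mulrC; apply: qM.
pose w x y : (D^o * D^o)%type := (x, y).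
change (X (w x0 y0)).
have -> : w x0 y0 = x0 *: (w 1 0 - c *: w x0 y0) + y0 *: (w 0 1 - d *: w x0 y0)
    + t *: w x0 y0.
  by rewrite /t; congr pair; rewrite /= /GRing.scale /=; ring.
by apply: (XD); [apply: XD; apply: XZ | apply/NX/qN].
Qed.

(** Induction on the generators keeps a nonzero [p] in [q] dividing those already treated, up to a
    factor [s] outside [q]. For a new generator [x], either [p] divides it locally at [q] or [x]
    replaces [p]. *)
Lemma noetherian_locally_principal q : ideals_fg -> free2_cl_Hilbert D ->
  prime_ideal q -> (exists2 a, q a & a <> 0) -> locally_principal q.
Proof.
move=> fg hilb qprime [a qa a0]; have [iq nq1 qp] := qprime; have [q0 qD qM] := iq.
have [n [e gen]] := fg q iq.
have [p [s [[qp' p0 nqs] sp]]] : exists p s : D, [/\ q p, p <> 0 & ~ q s] /\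
    forall x, x \in codom e -> exists y, s * x = p * y.
  have : forall x, x \in codom e -> q x.
    by move=> _ /codomP[i ->]; exact: generated_by_mem gen.
  elim: (codom e) => [|x l IH] lq; first by exists a, 1.
  have [|p [s [[qp' p0 nqs] sp]]] := IH;
    first by move=> y yl; apply: lq; rewrite in_cons yl orbT.
  have [x0|x0] := pselect (x = 0).
    exists p, s; split=> // y; rewrite in_cons => /predU1P[->|/sp] //.
    by exists 0; rewrite x0 !mulr0.
  have [u [v [uv [nqu|nqv]]]] := free2_proportional x fg hilb qprime p0.
    exists p, (s * u); split; first by split=> //; case/qp.
    move=> y; rewrite in_cons => /predU1P[->|/sp[w yw]].
      by exists (s * v); rewrite -mulrA [u * x]mulrC -uv mulrCA.
    by exists (u * w); rewrite mulrAC yw mulrAC mulrA.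
  exists x, (s * v); split; first by split; [apply: lq; apply: mem_head | | case/qp].
  move=> y; rewrite in_cons => /predU1P[->|/sp[w yw]].
    by exists (s * v); rewrite mulrC.
  by exists (u * w); rewrite mulrAC yw mulrAC uv mulrA.
exists p, s; split=> // x /gen[c ->].
have [y yP] := boolp.choice (fun i => sp (e i) (codom_f e i)).
exists (\sum_i c i * y i); rewrite !big_distrr; apply: eq_bigr => i _ /=.
by rewrite mulrCA yP mulrCA.
Qed.

(** For a maximal counterexample [I] and a maximal ideal [m] above it, [K = (I : m)] is strictly
    larger than [I] and [I = m K], so a factorization of [K] yields one of [I]. *)
Lemma noetherian_prime_factorization : ideals_fg -> free2_cl_Hilbert D ->
  prime_factorization D.
Proof.
move=> fg hilb I0 iI0 nI01; apply: contrapT => nofact0.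
pose factors J := exists2 s, forall P, P \in s -> prime_ideal P & J = prod_ideal [set 0] s.
have [||I [[iI nI1 Ifact] _ Imax]] :=
  @ideals_fg_max [set J | [/\ ideal J, ~ J 1 & ~ factors J]] I0 fg.
- by move=> J [].
- by split=> // -[s sP sE]; apply: nofact0; exists s.
have sub0 J : ideal J -> [set 0] `<=` J := @set0_subI D J.
have [I00 ID IM] := iI.
(* The zero ideal is prime, hence its own factorization. *)
have [a Ia a0] : exists2 a, I a & a <> 0.
  apply: contrapT => none; apply: Ifact.
  have I0E : I = [set 0].
    apply/seteqP; split=> [x Ix|]; last exact: sub0.
    by apply: contrapT => x0; apply: none; exists x.
  exists [:: I]; last by rewrite /= mul_idealC mul_idealTl //; exact: sub0.
  by move=> P; rewrite inE => /eqP ->; split=> // u v; rewrite I0E => /domD.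
have [||m [[im nm1] Im mmax]] := @ideals_fg_max [set J | ideal J /\ ~ J 1] I fg.
- by move=> J [].
- by [].
have [m0 mD mM] := im.
have mmx : max_ideal m.
  split=> // x nmx; apply: contrapT => n1; apply: nmx.
  apply: (mmax [set y | exists c, m (y - c * x)]).
  - by split=> //; exact: ideal_adjoin.
  - by move=> y my; exists 0; rewrite mul0r subr0.
  - by exists 1; rewrite mul1r subrr.
have mprime := max_ideal_prime mmx.
have [p [s [mp nms sp]]] : locally_principal m.
  by apply: noetherian_locally_principal => //; exists a => //; apply: Im.
have s0 : s <> 0 by move=> s0; apply: nms; rewrite s0.
pose K := [set x | forall y, m y -> I (x * y)].
have iK : ideal K.
  split=> [y my|u v Ku Kv y my|c u Ku y my]; first by rewrite mul0r.
    by rewrite mulrDl; apply: ID; [apply: Ku|apply: Kv].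
  by rewrite -mulrA; apply: IM; apply: Ku.
have IK : I `<=` K by move=> x Ix y my; rewrite mulrC; apply: IM.
have [M0 MD MM] := mul_ideal_ideal [set 0] m K.
have ImK : I = mul_ideal [set 0] m K.
  apply/seteqP; split=> [x Ix|]; last first.
    by apply: mul_ideal_sub => //; [exact: sub0 | move=> y z my Kz; rewrite mulrC; apply: Kz].
  (* [u] inverts [s] modulo [m], so [x] is the sum of [(1 - u s) x], in [m I], and [u p y]. Here [y]
     is in [K]: for [z] in [m] with [s z = p w], cancelling [s] gives [y z = w x]. *)
  have [_ _ /(_ s nms)[u mu]] := mmx.
  have [y sx] := sp x (Im x Ix).
  have Ky : K y.
    move=> z mz; have [w sz] := sp z mz.
    have -> : y * z = w * x; last exact: IM.
    by apply: (domain_cancel domD s0); rewrite mulrCA sz [RHS]mulrCA sx; ring.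
  have -> : x = (1 - u * s) * x + u * (p * y) by rewrite -sx; ring.
  apply: MD; last by apply: MM; apply: mul_ideal_in.
  by apply: mul_ideal_in => //; apply: IK.
(* Otherwise [I = m I], and Nakayama with [s = 1] makes [I] zero. *)
have nKI : ~ K `<=` I.
  move=> KI; apply: a0; apply: (@nakayama m I 1) => // x Ix.
  have IKE : K = I by apply/seteqP.
  by rewrite mul1r -IKE -ImK.
apply: Ifact.
have [t tP KE] : factors K.
  have [K1|nK1] := pselect (K 1).
    exists [::] => //; apply/seteqP; split=> // x _.
    by rewrite -[x]mulr1; case: iK => _ _; apply.
  by apply: contrapT => nK; apply/nKI/Imax.
exists (m :: t); last by rewrite /= -KE.
by move=> P; rewrite in_cons => /predU1P[->|/tP].
Qed.

End NoetherianDomain.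

(** * The equivalences *)

Lemma ideal_mulE (R : comNzRingType) (I J : {pred R}) : ideal [set` I] ->
  [set` ideal_mul I J] = mul_ideal [set 0] [set` I] [set` J].
Proof.
move=> [I0 ID IM]; apply/seteqP; split=> [x /asboolP[n [a [b [Ia Jb ->]]]]|].
  apply: (@submod_sum R R^o _) => [|i]; first exact: mul_ideal_ideal.
  by apply: mul_ideal_in; [apply: Ia | apply: Jb].
apply: mul_ideal_sub => [|_ ->|a b Ia Jb]; last first.
- by apply/asboolP; exists 1, (fun=> a), (fun=> b); rewrite big_ord1.
- apply/asboolP; exists 0, (fun=> 0), (fun=> 0); rewrite big_ord0.
  by split=> // -[].
split=> [|u v /asboolP[n [a [b [Ia Jb ->]]]] /asboolP[n' [a' [b' [Ia' Jb' ->]]]]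
  |c u /asboolP[n [a [b [Ia Jb ->]]]]]; apply/asboolP.
- by exists 0, (fun=> 0), (fun=> 0); rewrite big_ord0; split=> // -[].
- exists (n + n')%N,
    (fun i => match fintype.split i with inl j => a j | inr j => a' j end),
    (fun i => match fintype.split i with inl j => b j | inr j => b' j end).
  split=> [i|i|]; [by case: (fintype.split i)|by case: (fintype.split i)|].
  rewrite big_split_ord; congr (_ + _); apply: eq_bigr => i _.
    by rewrite -[lshift _ _]/(unsplit (inl i)) unsplitK.
  by rewrite -[rshift _ _]/(unsplit (inr i)) unsplitK.
- exists n, (fun i => c * a i), b; split=> // [i|]; first exact: (IM c _ (Ia i)).
  by rewrite big_distrr; apply: eq_bigr => i _; rewrite /= mulrA.
Qed.

Lemma foldr_ideal_mulE (R : comNzRingType) (s : seq (prime_idealr R)) :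
  [set` foldr (fun (Q : prime_idealr R) J => ideal_mul Q J) predT s] =
  prod_ideal [set 0] [seq [set` (Q : prime_idealr R)] | Q <- s].
Proof.
elim: s => [|Q s IH] /=; first exact/seteqP.
rewrite -IH; apply: ideal_mulE; exact: idealr_ideal.
Qed.

Lemma Dedekind_domainP (R : comNzRingType) : Dedekind_domain R <->
  GRing.integral_domain_axiom R /\ prime_factorization R.
Proof.
split=> -[dom fact]; split=> // I.
  move=> iI nI1; have [J JE] := ideal_idealr iI nI1; have [s sE] := fact J.
  exists [seq [set` (Q : prime_idealr R)] | Q <- s].
    elim: s {sE} => //= Q s IH P; rewrite in_cons => /predU1P[->|/IH //].
    exact: prime_idealr_prime_ideal.
  by rewrite -foldr_ideal_mulE -JE; apply/seteqP; split=> x /=; rewrite sE.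
have [|s sP sE] := fact _ (idealr_ideal I); first by rewrite /= idealr1.
have [t tE] : exists t : seq (prime_idealr R), [seq [set` (Q : prime_idealr R)] | Q <- t] = s.
  elim: s sP {sE} => [|P s IH] sP; first by exists [::].
  have [|t <-] := IH; first by move=> Q Qs; apply: sP; rewrite in_cons Qs orbT.
  have [Q <-] := prime_ideal_prime_idealr (sP P (mem_head _ _)).
  by exists (Q :: t).
exists t => x; apply/idP/idP => [Ix|].
  have : [set` I] x by [].
  by rewrite sE -tE -foldr_ideal_mulE.
move=> tx; suff : [set` I] x by [].
by rewrite sE -tE -foldr_ideal_mulE.
Qed.

Lemma noetherianP (R : comNzRingType) : noetherian R -> ideals_fg R.
Proof.
move=> noeth I iI.
have [|n [e gen]] := noeth (@setpred R^o I).
  by apply/submod_closedP; rewrite setpredK.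
by exists n, e => x; rewrite -gen in_setpred.
Qed.

Lemma ideals_fg_quot (R : comNzRingType) (P : idealr R) :
  ideals_fg R -> ideals_fg {ideal_quot P}.
Proof.
move=> fg I [I0 ID IM]; pose f := quot_map P.
have [|n [e gen]] := fg (f @^-1` I).
  by split=> /= [|u v Iu Iv|a u Iu]; rewrite ?rmorph0 ?rmorphD ?rmorphM;
     [|apply: ID|apply: IM].
exists n, (f \o e) => y; split=> [Iy|[c ->]].
  have [x xy] := quot_map_surj y; have /gen[c xE] : (f @^-1` I) x by rewrite /= /f xy.
  exists (f \o c); rewrite -xy xE rmorph_sum.
  by apply: eq_bigr => i _; rewrite rmorphM.
apply: (@submod_sum _ {ideal_quot P}^o I) => // i; apply: IM.
exact: (generated_by_mem i gen).
Qed.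

(** The identity, named so that it can be declared additive and serve as a semilinear surjection. *)
Definition unrestr (R S : comNzRingType) (f : {rmorphism R -> S}) (M : lmodType S) :
  restr f M -> M := id.
Fact unrestr_is_zmod_morphism (R S : comNzRingType) (f : {rmorphism R -> S}) (M : lmodType S) :
  zmod_morphism (@unrestr R S f M).
Proof. by []. Qed.
HB.instance Definition _ (R S : comNzRingType) (f : {rmorphism R -> S}) (M : lmodType S) :=
  GRing.isZmodMorphism.Build (restr f M) M (@unrestr R S f M)
    (@unrestr_is_zmod_morphism R S f M).

Section MainTheorem.
Variable R : comNzRingType.

Lemma fg_modules_quot (P : idealr R) :
  fg_modules_cl_Hilbert R -> fg_modules_cl_Hilbert {ideal_quot P}.
Proof.
move=> hilb M fgM; pose f := quot_map P.
have f_surj : forall s, exists a, f a = s := @quot_map_surj R P.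
pose g : {additive restr f M -> M} := @unrestr R _ f M.
have g_surj y : exists x, g x = y by exists y.
apply: (cl_Hilbert_im (g := g) f_surj g_surj) => //.
by apply: hilb; apply: finitely_generated_restr.
Qed.

(** [(N : M)] contains a minimal prime [P], so [M / N] is a finitely generated module over
    [R / P]. *)
Lemma fg_modules_minimal :
  (forall P : prime_idealr R, minimal_prime P -> fg_modules_cl_Hilbert {ideal_quot P}) ->
  fg_modules_cl_Hilbert R.
Proof.
move=> hilb M fgM; apply/cl_HilbertP => N m Np nNm.
have [P [Pmin PN]] := minimal_prime_below (cl_prime_colon Np).
have f_surj := @quot_map_surj R P.
have [sN _ _] := Np.
have [a x /quot_map_eq0 Pa|Q [g [g_surj gZ gN]]] := quotient_module f_surj sN.
  exact: (PN a Pa).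
apply: (cl_Hilbert_preim f_surj g_surj gZ) => //; last by move=> x /gN.
exact/(hilb P Pmin)/(finitely_generated_im g_surj gZ).
Qed.

Lemma finitely_generated_free2 : finitely_generated (R^o * R^o)%type.
Proof.
exists 2%N, (fun i : 'I_2 => if i == ord0 then (1, 0) else (0, 1) : (R^o * R^o)%type).
move=> [x y]; split=> // _; exists (fun i => if i == ord0 then x else y).
rewrite big_ord_recl big_ord1 /=; congr pair; rewrite /= /GRing.scale /=.
  by rewrite mulr1 mulr0 addr0.
by rewrite mulr1 mulr0 add0r.
Qed.

Section Free2.
Variable P : idealr R.

Definition free2_map (z : R^o * R^o) : ({ideal_quot P}^o * {ideal_quot P}^o)%type :=
  (quot_map P z.1, quot_map P z.2).

Fact free2_map_is_zmod_morphism : zmod_morphism free2_map.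
Proof. by move=> x y; rewrite /free2_map /= !rmorphB. Qed.
HB.instance Definition _ :=
  GRing.isZmodMorphism.Build _ _ free2_map free2_map_is_zmod_morphism.

Lemma free2_map_surj y : exists x, free2_map x = y.
Proof.
case: y => y z; have [[a ay] [b bz]] := (quot_map_surj y, quot_map_surj z).
by exists (a, b); rewrite /free2_map ay bz.
Qed.

Lemma free2_mapZ a x : free2_map (a *: x) = quot_map P a *: free2_map x.
Proof. by rewrite /free2_map /= /GRing.scale /= !rmorphM. Qed.
End Free2.

Lemma free2_quot (P : idealr R) :
  free2_cl_Hilbert R -> free2_cl_Hilbert {ideal_quot P}.
Proof.
apply: (cl_Hilbert_im (f := quot_map P) (g := @free2_map P)).
- exact: quot_map_surj.
- exact: free2_map_surj.
- exact: free2_mapZ.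
Qed.

(** [N] contains the kernel of [free2_map], because [(x, y) = x (1, 0) + y (0, 1)] and [P] carries
    every vector into [N]. *)
Lemma free2_minimal :
  (forall P : prime_idealr R, minimal_prime P -> free2_cl_Hilbert {ideal_quot P}) ->
  free2_cl_Hilbert R.
Proof.
move=> hilb; apply/cl_HilbertP => N m Np nNm.
have [P [Pmin PN]] := minimal_prime_below (cl_prime_colon Np).
apply: (cl_Hilbert_preim (f := quot_map P) (g := @free2_map P)) => //.
- exact: quot_map_surj.
- exact: free2_map_surj.
- exact: free2_mapZ.
- exact: hilb.
move=> [x y] /pair_equal_spec[/quot_map_eq0 Px /quot_map_eq0 Py].
have [[N0 ND NZ] _ _] := Np.
pose w a b : (R^o * R^o)%type := (a, b).
change (N (w x y)); have -> : w x y = x *: w 1 0 + y *: w 0 1.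
  by congr pair; rewrite /= /GRing.scale /=; ring.
by apply: ND; apply: PN.
Qed.

(** The pairs with first coordinate in [P] form a classical prime. A maximal submodule above it
    contains all [(0, c)], so it consists of the pairs with first coordinate in a maximal ideal [r]
    above [P]. *)
Lemma free2_Hilbert_ring : free2_cl_Hilbert R -> Hilbert_ring R.
Proof.
move=> /cl_HilbertP hilb P.
have [[P0 PD PM] nP1 Pp] := prime_idealr_prime_ideal P.
exists (fun I => maximal_ideal I /\ {subset P <= I}); split=> [I []//|x].
split=> [Px I [_]|Px]; first exact.
apply: contrapT => nPx.
pose w a b : (R^o * R^o)%type := (a, b).
have Np : cl_prime [set z : R^o * R^o | z.1 \in P].
  split.
  - split=> [|u v|a u]; [exact: P0 | exact: PD | exact: PM].
  - by exists (w 1 0).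
  - move=> a b z; rewrite /= /GRing.scale /= -mulrA => /Pp[Pa|]; last by right.
    by left; rewrite mulrC; apply: PM.
have [X [[sX _ Xmax] NX nXx]] := hilb _ (w x 0) Np nPx.
have [X0 XD XZ] := sX.
pose r := [set a | X (w a 0)].
have wE a b : X (w a b) <-> r a.
  have Xb c : X (w 0 c) by apply: NX; exact: P0.
  have wD : w a b = w a 0 + w 0 b by congr pair; rewrite /= ?addr0 ?add0r.
  rewrite wD; split=> [|ra]; last exact: XD.
  by rewrite addrC => /(submodDl sX (Xb b)).
have rmax : max_ideal r.
  split.
  - split=> [|u v ru rv|a u ru]; first exact: X0.
      by apply/(wE _ (0 + 0)); apply: (XD (w u 0) (w v 0)).
    by apply/(wE _ (a *: (0 : R^o))); apply: (XZ a (w u 0)).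
  - move=> r1; apply: nXx; have -> : w x 0 = x *: w 1 0; last exact: XZ.
    by congr pair; rewrite /= /GRing.scale /=; ring.
  - move=> z nrz; have [a Xa] := Xmax (w z 0) nrz (w 1 0).
    by exists a; exact: (wE (1 - a * z) (0 - a * 0)).1 Xa.
have [I IE] := ideal_idealr (let: And3 i _ _ := rmax in i) (let: And3 _ n _ := rmax in n).
have /Px Ix : maximal_ideal I /\ {subset P <= I}.
  split; first exact: max_ideal_maximal IE.
  move=> y Py; suff : [set` I] y by [].
  by rewrite IE; apply: NX.
by apply: nXx; change (r x); rewrite -IE.
Qed.

(** The Jacobson radical of [R / P] is zero: take the image of a maximal ideal that contains [P] and
    avoids a lift of [c]. *)
Lemma Hilbert_quot (P : prime_idealr R) (c : {ideal_quot P}) :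
  Hilbert_ring R -> c <> 0 -> exists2 r, max_ideal r & ~ r c.
Proof.
move=> hilb c0; have [a ac] := quot_map_surj c.
have [F [Fmax FP]] := hilb P.
have [I [FI nIa]] : exists I, F I /\ a \notin I.
  apply: contrapT => none; apply: c0; rewrite -ac; apply/quot_map_eq0/FP => I FI.
  by apply/negPn/negP => nIa; apply: none; exists I.
have PI x : x \in P -> x \in I by move=> /FP; apply.
have [[I0 ID IM] nI1 Imax] := max_idealP (Fmax I FI).
pose r := [set y | exists2 x, x \in I & quot_map P x = y].
have rE x : r (quot_map P x) <-> x \in I.
  split=> [[y Iy yx]|Ix]; last by exists x.
  rewrite -(subrK y x); apply: ID => //; apply/PI/quot_map_eq0.
  by rewrite rmorphB yx subrr.
exists r; last by rewrite -ac rE; apply/negP.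
split; last 1 first.
- move=> y; have [x <-] := quot_map_surj y; rewrite rE => /Imax[d Id].
  by exists (quot_map P d); rewrite -rmorphM -(rmorph1 (quot_map P)) -rmorphB rE.
- split=> [|_ _ [u Iu <-] [v Iv <-]|y _ [u Iu <-]].
  + by rewrite -(rmorph0 (quot_map P)) rE.
  + by rewrite -rmorphD rE; apply: ID.
  + by have [b <-] := quot_map_surj y; rewrite -rmorphM rE; apply: IM.
- by rewrite -(rmorph1 (quot_map P)) rE.
Qed.

Lemma Dedekind_fg_modules : Hilbert_ring R ->
  (forall P : prime_idealr R, minimal_prime P -> Dedekind_domain {ideal_quot P}) ->
  fg_modules_cl_Hilbert R.
Proof.
move=> hilb ded; apply: fg_modules_minimal => P Pmin M.
have /Dedekind_domainP[dom fact] := ded P Pmin.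
have domD (a b : {ideal_quot P}) : a * b = 0 -> a = 0 \/ b = 0.
  by move=> /dom/orP[/eqP|/eqP]; [left|right].
apply: fg_cl_Hilbert => // [c|q qp [a qa a0]]; first exact: Hilbert_quot.
exact: dedekind_prime a0.
Qed.

Lemma noetherian_Dedekind (P : prime_idealr R) : noetherian R ->
  free2_cl_Hilbert {ideal_quot P} -> Dedekind_domain {ideal_quot P}.
Proof.
move=> noeth hilb; have dom := @Quotient.rquot_IdomainAxiom R P.
apply/Dedekind_domainP; split=> //; apply: noetherian_prime_factorization => //.
  by move=> a b /dom/orP[/eqP|/eqP]; [left|right].
exact/ideals_fg_quot/noetherianP.
Qed.

End MainTheorem.

Theorem theorem3p7 (R : comNzRingType) :
  let S1 := fg_modules_cl_Hilbert R in
  let S2 := forall P : prime_idealr R, minimal_prime P ->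
              fg_modules_cl_Hilbert {ideal_quot P} in
  let S3 := free2_cl_Hilbert R in
  let S4 := forall P : prime_idealr R, minimal_prime P ->
              free2_cl_Hilbert {ideal_quot P} in
  let S5 := Hilbert_ring R /\
            (forall P : prime_idealr R, minimal_prime P ->
               Dedekind_domain {ideal_quot P}) in
  [/\ S1 <-> S2, S2 -> S3, S3 <-> S4 & S5 -> S1] /\
  (noetherian R -> [<-> S1; S2; S3; S4; S5]).
Proof.
move=> S1 S2 S3 S4 S5.
have S12 : S1 -> S2 by move=> hilb P _; exact: fg_modules_quot.
have S21 : S2 -> S1 := @fg_modules_minimal R.
have S23 : S2 -> S3 by move=> /S21; apply; exact: finitely_generated_free2.
have S34 : S3 -> S4 by move=> hilb P _; exact: free2_quot.
have S43 : S4 -> S3 := @free2_minimal R.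
have S51 : S5 -> S1 by case; exact: Dedekind_fg_modules.
split=> [//|noeth]; tfae=> //.
(* Only [S4 -> S5] is left of the cycle; this is where the Noetherian hypothesis enters. *)
move=> hilb; split=> [|P Pmin]; first exact/free2_Hilbert_ring/S43.
exact/noetherian_Dedekind/hilb.
Qed.
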